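(* There is a recursive set $\mathrm{ACFC}$ of $\forall\exists$-axioms in the language $L$ such that: (1) for all $(F,K;\chi)$, where $F,K$ are integral domains and $\chi:F\to K$ is a character, we have $(F,K;\chi)\models \mathrm{ACFC}$ if and only if $F$ and $K$ are algebraically closed fields, $\mathrm{char}(K)=0$ and $\chi:F\to K$ is generic; (2) for every prime $p$, if $\mathbb{F}$ is an algebraic closure of a finite field with $\mathrm{char}(\mathbb{F})=p$ and $\chi:\mathbb{F}\to\mathbb{C}$ is an injective character, then $(\mathbb{F},\mathbb{C};\chi)\models\mathrm{ACFC}$.
   Context: A character $\chi:F\to K$ between integral domains is a map with $\chi(ab)=\chi(a)\chi(b)$ for all $a,b\in F$, $\chi(0)=0$ and $\chi(1)=1$. A structure $(F,K;\chi)$ of this kind is a structure in the $2$-sorted language $L$, which consists of two disjoint copies of the language of rings (one for each sort) augmented by a unary function symbol $\chi$ from the first sort to the second. For $n\ge 1$, $\alpha=(\alpha_1,\dots,\alpha_n)\in F^n$ and $k\in\mathbb{N}^n$ (with $0\in\mathbb{N}$) put $\alpha^k=\alpha_1^{k_1}\cdots\alpha_n^{k_n}$. The tuple $\alpha$ is multiplicatively dependent if $\alpha^k=\alpha^l$ for some distinct $k,l\in\mathbb{N}^n$, and multiplicatively independent otherwise. A character $\chi:F\to K$ is generic if it is injective and, for every $n\ge1$ and every multiplicatively independent $\alpha\in F^n$, the tuple $\chi(\alpha)=(\chi(\alpha_1),\dots,\chi(\alpha_n))\in K^n$ is algebraically independent, in the fraction field of $K$, over its prime field. *)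

(* Defs.v *)
From Stdlib Require Eqdep_dec.
From mathcomp Require Import all_boot all_order all_algebra.
From mathcomp Require Import mpoly complex.
From mathcomp Require Import reals.

Set Implicit Arguments.
Unset Strict Implicit.
Unset Printing Implicit Defensive.

Import GRing.Theory.

(** * Recursive sets of natural numbers *)

(* Kleene's general recursive functions: the least class of total functions
   nat^n -> nat containing the initial functions and closed under composition,
   primitive recursion and minimization of regular functions.  The closure
   conditions are stated pointwise, so that [recursive] is invariant under
   extensional equality. *)
Inductive recursive : forall n, (n.-tuple nat -> nat) -> Prop :=
| recursive_zero (f : 0.-tuple nat -> nat) :
    (forall v, f v = 0) -> recursive f
| recursive_succ (f : 1.-tuple nat -> nat) :
    (forall v, f v = (thead v).+1) -> recursive f
| recursive_proj n (i : 'I_n) (f : n.-tuple nat -> nat) :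
    (forall v, f v = tnth v i) -> recursive f
| recursive_comp m n (h : m.-tuple nat -> nat)
    (g : 'I_m -> n.-tuple nat -> nat) (f : n.-tuple nat -> nat) :
    recursive h -> (forall i, recursive (g i)) ->
    (forall v, f v = h [tuple g i v | i < m]) -> recursive f
| recursive_prim n (g : n.-tuple nat -> nat) (h : n.+2.-tuple nat -> nat)
    (f : n.+1.-tuple nat -> nat) :
    recursive g -> recursive h ->
    (forall v : n.-tuple nat, f [tuple of 0 :: v] = g v) ->
    (forall x (v : n.-tuple nat), f [tuple of x.+1 :: v] =
                 h [tuple of x :: f [tuple of x :: v] :: v]) ->
    recursive f
| recursive_mu n (g : n.+1.-tuple nat -> nat) (f : n.-tuple nat -> nat) :
    recursive g ->
    (forall v : n.-tuple nat, g [tuple of f v :: v] = 0) ->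
    (forall (v : n.-tuple nat) y, y < f v -> g [tuple of y :: v] <> 0) ->
    recursive f.

(* The characteristic function of [A], with values 0 and 1, is recursive. *)
Definition recursive_set (A : nat -> Prop) : Prop :=
  exists b : pred nat,
    recursive (fun v : 1.-tuple nat => nat_of_bool (b (thead v))) /\
    forall m, A m <-> b m.

(** * The two-sorted language L *)

Variant sort := Dom | Cod.

Inductive term : sort -> Type :=
| tVar s of nat : term s
| tZero s : term s
| tOne s : term s
| tAdd s of term s & term s : term s
| tOpp s of term s : term s
| tMul s of term s & term s : term s
| tChi of term Dom : term Cod.

Inductive formula : Type :=
| fBot
| fEq s of term s & term s
| fNot of formula
| fAnd of formula & formula
| fOr of formula & formula
| fImp of formula & formula
| fForall (s : sort) (x : nat) of formula
| fExists (s : sort) (x : nat) of formula.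

Fixpoint term_free (s' : sort) (y : nat) s (t : term s) : Prop :=
  match t with
  | tVar s x => s = s' /\ x = y
  | tZero _ | tOne _ => False
  | tAdd _ t u | tMul _ t u => term_free s' y t \/ term_free s' y u
  | tOpp _ t => term_free s' y t
  | tChi t => term_free s' y t
  end.

Fixpoint formula_free (s' : sort) (y : nat) (phi : formula) : Prop :=
  match phi with
  | fBot => False
  | fEq _ t u => term_free s' y t \/ term_free s' y u
  | fNot phi => formula_free s' y phi
  | fAnd phi psi | fOr phi psi | fImp phi psi =>
      formula_free s' y phi \/ formula_free s' y psi
  | fForall s x phi | fExists s x phi =>
      (s, x) <> (s', y) /\ formula_free s' y phi
  end.

Definition sentence (phi : formula) : Prop :=
  forall s x, ~ formula_free s x phi.

Fixpoint quantifier_free (phi : formula) : bool :=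
  match phi with
  | fBot | fEq _ _ _ => true
  | fNot phi => quantifier_free phi
  | fAnd phi psi | fOr phi psi | fImp phi psi =>
      quantifier_free phi && quantifier_free psi
  | fForall _ _ _ | fExists _ _ _ => false
  end.

Fixpoint exists_prefix (phi : formula) : bool :=
  if phi is fExists _ _ psi then exists_prefix psi else quantifier_free phi.

(* A (possibly empty) block of universal quantifiers, followed by a (possibly
   empty) block of existential ones, followed by a quantifier-free formula;
   both blocks may bind variables of either sort. *)
Fixpoint forall_exists (phi : formula) : bool :=
  if phi is fForall _ _ psi then forall_exists psi else exists_prefix phi.

(** * Goedel numbering *)

Definition sort_code (s : sort) : nat := if s is Dom then 0 else 1.

Fixpoint term_code s (t : term s) : nat :=
  match t with
  | tVar s x => CodeSeq.code [:: 0; sort_code s; x]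
  | tZero s => CodeSeq.code [:: 1; sort_code s]
  | tOne s => CodeSeq.code [:: 2; sort_code s]
  | tAdd _ t u => CodeSeq.code [:: 3; term_code t; term_code u]
  | tOpp _ t => CodeSeq.code [:: 4; term_code t]
  | tMul _ t u => CodeSeq.code [:: 5; term_code t; term_code u]
  | tChi t => CodeSeq.code [:: 6; term_code t]
  end.

Fixpoint formula_code (phi : formula) : nat :=
  match phi with
  | fBot => CodeSeq.code [:: 0]
  | fEq _ t u => CodeSeq.code [:: 1; term_code t; term_code u]
  | fNot phi => CodeSeq.code [:: 2; formula_code phi]
  | fAnd phi psi => CodeSeq.code [:: 3; formula_code phi; formula_code psi]
  | fOr phi psi => CodeSeq.code [:: 4; formula_code phi; formula_code psi]
  | fImp phi psi => CodeSeq.code [:: 5; formula_code phi; formula_code psi]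
  | fForall s x phi => CodeSeq.code [:: 6; sort_code s; x; formula_code phi]
  | fExists s x phi => CodeSeq.code [:: 7; sort_code s; x; formula_code phi]
  end.

Lemma sort_code_inj : injective sort_code.
Proof. by case; case. Qed.

Lemma existT_term_inj s (t u : term s) :
  existT term s t = existT term s u -> t = u.
Proof. by apply: Eqdep_dec.inj_pair2_eq_dec; decide equality. Qed.

Lemma term_code_existT s (t : term s) s' (u : term s') :
  term_code t = term_code u -> existT term s t = existT term s' u.
Proof.
have codeI := can_inj CodeSeq.codeK.
elim: t s' u => {s} [s x|s|s|s t IHt t' IHt'|s t IHt|s t IHt t' IHt'|t IHt] _
  [s' y|s'|s'|s' u u'|s' u|s' u u'|u] /codeI //.
- by case=> /sort_code_inj-> ->.
- by case=> /sort_code_inj->.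
- by case=> /sort_code_inj->.
- case=> /IHt E /IHt' E'; have Es : s = s' := congr1 (@projT1 _ _) E.
  by case: s' / Es u u' E E' => u u' /existT_term_inj-> /existT_term_inj->.
- case=> /IHt E; have Es : s = s' := congr1 (@projT1 _ _) E.
  by case: s' / Es u E => u /existT_term_inj->.
- case=> /IHt E /IHt' E'; have Es : s = s' := congr1 (@projT1 _ _) E.
  by case: s' / Es u u' E E' => u u' /existT_term_inj-> /existT_term_inj->.
- by case=> /IHt/existT_term_inj->.
Qed.

Lemma formula_code_inj : injective formula_code.
Proof.
have codeI := can_inj CodeSeq.codeK.
have eqI s (t t' : term s) s' (u u' : term s') :
    existT term s t = existT term s' u ->
    existT term s t' = existT term s' u' -> fEq t t' = fEq u u'.
  move=> E E'; have Es : s = s' := congr1 (@projT1 _ _) E.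
  by case: s' / Es u u' E E' => u u' /existT_term_inj-> /existT_term_inj->.
elim=> [|s t t'|p IHp|p IHp q IHq|p IHp q IHq|p IHp q IHq|s x p IHp|s x p IHp]
  [|s' u u'|p'|p' q'|p' q'|p' q'|s' x' p'|s' x' p'] /codeI //.
- by case=> /term_code_existT E /term_code_existT; apply: eqI.
- by case=> /IHp->.
- by case=> /IHp-> /IHq->.
- by case=> /IHp-> /IHq->.
- by case=> /IHp-> /IHq->.
- by case=> /sort_code_inj-> -> /IHp->.
- by case=> /sort_code_inj-> -> /IHp->.
Qed.

Definition recursive_theory (T : formula -> Prop) : Prop :=
  recursive_set (fun m => exists2 phi, T phi & formula_code phi = m).

(** * Structures and satisfaction *)

Record structure := Structure {
  carrier :> sort -> Type;
  s_zero : forall s, carrier s;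
  s_one : forall s, carrier s;
  s_add : forall s, carrier s -> carrier s -> carrier s;
  s_opp : forall s, carrier s -> carrier s;
  s_mul : forall s, carrier s -> carrier s -> carrier s;
  s_chi : carrier Dom -> carrier Cod
}.

Section Satisfaction.

Variable M : structure.

Definition assignment := forall s, nat -> M s.

Fixpoint eval (e : assignment) s (t : term s) : M s :=
  match t with
  | tVar s x => e s x
  | tZero s => s_zero M s
  | tOne s => s_one M s
  | tAdd _ t u => s_add (eval e t) (eval e u)
  | tOpp _ t => s_opp (eval e t)
  | tMul _ t u => s_mul (eval e t) (eval e u)
  | tChi t => s_chi (eval e t)
  end.

Definition update (e : assignment) s (x : nat) : M s -> assignment :=
  match s return M s -> assignment with
  | Dom => fun a s' =>
      match s' return nat -> M s' with
      | Dom => fun y => if y == x then a else e Dom y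
      | Cod => e Cod
      end
  | Cod => fun a s' =>
      match s' return nat -> M s' with
      | Dom => e Dom
      | Cod => fun y => if y == x then a else e Cod y
      end
  end.

Fixpoint sat (e : assignment) (phi : formula) : Prop :=
  match phi with
  | fBot => False
  | fEq _ t u => eval e t = eval e u
  | fNot phi => ~ sat e phi
  | fAnd phi psi => sat e phi /\ sat e psi
  | fOr phi psi => sat e phi \/ sat e psi
  | fImp phi psi => sat e phi -> sat e psi
  | fForall s x phi => forall a : M s, sat (update e x a) phi
  | fExists s x phi => exists a : M s, sat (update e x a) phi
  end.

(* For a sentence, the choice of the assignment is irrelevant. *)
Definition models (T : formula -> Prop) : Prop :=
  forall phi, T phi -> forall e : assignment, sat e phi.

End Satisfaction.

Local Open Scope ring_scope.

Definition sort_ring (F K : idomainType) (s : sort) : idomainType :=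
  if s is Dom then F else K.

(* The L-structure (F, K; chi). *)
Definition char_structure (F K : idomainType) (chi : F -> K) : structure :=
  @Structure (fun s => sort_ring F K s)
    (fun s => 0 : sort_ring F K s) (fun s => 1 : sort_ring F K s)
    (fun s (a b : sort_ring F K s) => a + b)
    (fun s (a : sort_ring F K s) => - a)
    (fun s (a b : sort_ring F K s) => a * b)
    chi.

(** * Generic characters *)

Definition is_character (F K : idomainType) (chi : F -> K) : Prop :=
  [/\ forall a b, chi (a * b) = chi a * chi b, chi 0 = 0 & chi 1 = 1].

Definition mult_dependent (F : idomainType) n (alpha : n.-tuple F) : Prop :=
  exists k l : n.-tuple nat, k <> l /\
    \prod_(i < n) tnth alpha i ^+ tnth k i =
    \prod_(i < n) tnth alpha i ^+ tnth l i.

Definition mult_independent (F : idomainType) n (alpha : n.-tuple F) : Prop :=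
  ~ mult_dependent alpha.

(* The intersection of all subfields of [E]. *)
Definition prime_field (E : fieldType) (x : E) : Prop :=
  forall S : {pred E}, divring_closed S -> x \in S.

Definition alg_independent (E : fieldType) (k : E -> Prop) n
    (a : n.-tuple E) : Prop :=
  forall P : {mpoly E[n]},
    (forall m, k P@_m) -> P.@[tnth a] = 0 -> P = 0.

Definition generic (F K : idomainType) (chi : F -> K) : Prop :=
  injective chi /\
  forall n (alpha : n.-tuple F), (1 <= n)%N -> mult_independent alpha ->
    alg_independent (@prime_field {fraction K})
      [tuple tofrac (chi (tnth alpha i)) | i < n].

(** * Algebraically closed fields *)

(* Both conditions are needed: an integral domain which is not a field, e.g.
   the ring of algebraic integers, may satisfy [GRing.closed_field_axiom]. *)
Definition alg_closed_field (F : idomainType) : Prop :=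
  GRing.field_axiom F /\ GRing.closed_field_axiom F.

Definition algebraic_closure (k F : fieldType) (iota : {rmorphism k -> F}) :
    Prop :=
  alg_closed_field F /\ forall x : F, algebraicOver iota x.

(* Main.v *)
Require Import Defs.
From HB Require Import structures.
From mathcomp Require Import all_boot all_order all_algebra.
From mathcomp Require Import cyclic all_field.
From mathcomp Require Import mpoly complex.
From mathcomp Require Import boolp reals.
From mathcomp Require Import zify ring.

(** Why the theorem holds.

    A generic character only satisfies the additive relations that are forced by
    roots of unity, and these are bounded by Mann's theorem; this turns
    genericity into a schema of universal sentences with an explicit bound.

    Let [chi : F -> K] be generic, with [F] and [K] algebraically closed and [K]
    of characteristic [0], and let [c_0 chi(x_0) + ... + c_m chi(x_m) = 0] with
    nonzero integers [c_i] and nonzero [x_i].  As [F] has all roots, up to a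
    common factor each [x_i] is a root of unity [tau_i] times a monomial in a
    multiplicatively independent tuple [gamma] ([multiplicative_basis]).  The
    tuple [chi(gamma)] is algebraically independent over the prime field, hence
    also over the roots of unity ([spec_eq0], by means of resultants with
    cyclotomic polynomials), so that the terms with the same monomial as [x_0]
    already sum to [0].  They form a relation with integer coefficients between
    the roots of unity [chi(tau_i)].  By Mann's theorem
    ([mann_roots_of_unity]) some [j <> 0] among them is such that
    [chi(tau_j) / chi(tau_0)] has order dividing [(m + 1)!], and so
    [(x_j / x_0) ^ (m + 1)! = 1] ([generic_relation]).

    Dividing by [x_0], this is a first-order property of relations with a
    constant term, [mann_axiom], in which the coefficients range over a finite
    set of integers.  Conversely, assume it, and let [alpha] be multiplicatively
    independent with [P(chi(alpha)) = 0] for a nonzero polynomial [P] with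
    integer coefficients.  Then two distinct monomials in [alpha] have a
    quotient which is a root of unity, a contradiction ([mann_generic]).
    Together with the axioms for algebraically closed fields and the triviality
    of the kernel of [chi], these sentences axiomatize the class
    ([models_acfcP]).

    The codes of the axioms are given by functions defined by primitive
    recursion, whose values are at least as large as their argument, so that a
    code can be recognized by a bounded search ([recursive_set_codom]).

    Finally, over a finite field each algebraic element has two equal powers, so
    that an algebraic closure of a finite field contains no multiplicatively
    independent tuple, and every injective character on it is generic. *)

Set Implicit Arguments.
Unset Strict Implicit.
Unset Printing Implicit Defensive.

Import GRing.Theory Num.Theory.

(** * Recursive functions and recursive sets *)

Section Computability.

Local Open Scope nat_scope.

(** The functions of the class [recursive] act on tuples of a fixed length.
    Reading the arguments of [f] off a sequence, with missing entries being
    [0], lets one and the same [f] be used at all arities, so that composition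
    and recursion need no bookkeeping of lengths. *)
Definition computable (f : seq nat -> nat) :=
  forall n, recursive (fun v : n.-tuple nat => f v).

Lemma eq_recursive n (f g : n.-tuple nat -> nat) :
  f =1 g -> recursive f -> recursive g.
Proof.
move=> fg rf; apply: (@recursive_comp n n f (fun i v => tnth v i)) => // [i|v].
  exact: (@recursive_proj n i).
by rewrite -fg; congr f; apply: eq_from_tnth => i; rewrite tnth_mktuple.
Qed.

Lemma eq_computable f g : f =1 g -> computable f -> computable g.
Proof. by move=> fg cf n; apply: eq_recursive (cf n) => v. Qed.

Lemma computable_zero : computable (fun=> 0).
Proof.
move=> n; apply: (@recursive_comp 0 n (fun=> 0) (fun _ _ => 0)) => //.
- exact: recursive_zero.
- by case.
Qed.

Lemma computable_proj i : computable (fun v => nth 0 v i).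
Proof.
move=> n; have [lt_in|le_ni] := ltnP i n.
  apply: (@recursive_proj n (Ordinal lt_in)) => v.
  by rewrite (tnth_nth 0).
apply: eq_recursive (computable_zero n) => v.
by rewrite nth_default // size_tuple.
Qed.

Lemma computable_comp (h : seq nat -> nat) (gs : seq (seq nat -> nat)) :
    computable h -> (forall i, computable (nth (fun=> 0) gs i)) ->
  computable (fun v => h [seq g v | g <- gs]).
Proof.
move=> ch cgs n.
apply: (@recursive_comp (size gs) n (fun v => h v)
          (fun i v => nth (fun=> 0) gs i v)) => // [i|v]; first exact: cgs.
congr h; apply: (@eq_from_nth _ 0) => [|i]; rewrite size_map.
  by rewrite size_map size_enum_ord.
move=> lti; rewrite (nth_map (fun=> 0)) // (nth_map (Ordinal lti)) ?size_enum_ord //.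
by rewrite nth_enum_ord.
Qed.

Lemma computable_prim (g h : seq nat -> nat) (f : nat -> seq nat -> nat) :
    computable g -> computable h ->
    (forall v, f 0 v = g v) ->
    (forall x v, f x.+1 v = h [:: x, f x v & v]) ->
  computable (fun v => f (head 0 v) (behead v)).
Proof.
move=> cg ch f0 fS [|n].
  by apply: eq_recursive (cg 0) => v; rewrite tuple0 /= f0.
apply: (recursive_prim (g := fun v => g v) (h := fun v => h v)) => // x v.
by rewrite /= fS.
Qed.

Definition computable1 (f : nat -> nat) := computable (fun v => f (nth 0 v 0)).
Definition computable2 (f : nat -> nat -> nat) :=
  computable (fun v => f (nth 0 v 0) (nth 0 v 1)).
Definition computable3 (f : nat -> nat -> nat -> nat) :=
  computable (fun v => f (nth 0 v 0) (nth 0 v 1) (nth 0 v 2)).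

Lemma computable_comp1 f g :
  computable1 f -> computable g -> computable (fun v => f (g v)).
Proof.
move=> cf cg; apply: (@computable_comp _ [:: g]) cf _ => -[|i] //=.
by rewrite nth_nil; apply: computable_zero.
Qed.

Lemma computable_comp2 f g1 g2 :
    computable2 f -> computable g1 -> computable g2 ->
  computable (fun v => f (g1 v) (g2 v)).
Proof.
move=> cf c1 c2; apply: (@computable_comp _ [:: g1; g2]) cf _ => -[|[|i]] //=.
by rewrite nth_nil; apply: computable_zero.
Qed.

Lemma computable_comp3 f g1 g2 g3 :
    computable3 f -> computable g1 -> computable g2 -> computable g3 ->
  computable (fun v => f (g1 v) (g2 v) (g3 v)).
Proof.
move=> cf c1 c2 c3.
apply: (@computable_comp _ [:: g1; g2; g3]) cf _ => -[|[|[|i]]] //=.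
by rewrite nth_nil; apply: computable_zero.
Qed.

Lemma computable2_rec (f : nat -> nat -> nat) b h :
    computable1 b -> computable3 h ->
    (forall p, f p 0 = b p) -> (forall p i, f p i.+1 = h p i (f p i)) ->
  computable2 f.
Proof.
move=> cb ch f0 fS.
have cf : computable (fun v => f (head 0 (behead v)) (head 0 v)).
  apply: (@computable_prim (fun v => b (nth 0 v 0))
           (fun v => h (nth 0 v 2) (nth 0 v 0) (nth 0 v 1))
           (fun x v => f (head 0 v) x)) => //.
  exact: (computable_comp3 ch (computable_proj 2) (computable_proj 0)
                           (computable_proj 1)).
have cf' : computable2 (fun x p => f p x).
  by apply: eq_computable cf => -[|x [|y v]].
exact: (computable_comp2 cf' (computable_proj 1) (computable_proj 0)).
Qed.

Lemma computable1_rec (f : nat -> nat) h :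
    computable2 h -> (forall i, f i.+1 = h i (f i)) -> computable (fun=> f 0) ->
  computable1 f.
Proof.
move=> ch fS c0.
have : computable2 (fun _ : nat => f).
  apply: (computable2_rec (b := fun=> f 0) (h := fun _ i r => h i r)) => //.
  exact: (computable_comp2 ch (computable_proj 1) (computable_proj 2)).
by move=> c2; apply: (computable_comp2 c2 computable_zero (computable_proj 0)).
Qed.

Lemma computable1_succ : computable1 S.
Proof.
move=> n; pose g (_ : 'I_1) (v : n.-tuple nat) := nth 0 v 0.
apply: (@recursive_comp 1 n (fun v => (thead v).+1) g) => [|i|v].
- exact: recursive_succ.
- exact: computable_proj.
- by rewrite /thead tnth_mktuple.
Qed.

Lemma computable_succ f : computable f -> computable (fun v => (f v).+1).
Proof. exact: computable_comp1 computable1_succ. Qed.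

Lemma computable_const c : computable (fun=> c).
Proof.
by elim: c => [|c]; [exact: computable_zero | exact: computable_succ].
Qed.

Lemma computable1_pred : computable1 predn.
Proof.
apply: (computable1_rec (h := fun i _ => i)) => //.
- exact: (computable_proj 0).
- exact: computable_zero.
Qed.

Lemma computable2_add : computable2 addn.
Proof.
apply: (computable2_rec (b := id) (h := fun _ _ r => r.+1)).
- exact: (computable_proj 0).
- exact: (computable_succ (computable_proj 2)).
- by move=> p; rewrite addn0.
- by move=> p i; rewrite addnS.
Qed.

Lemma computable_add f g :
  computable f -> computable g -> computable (fun v => f v + g v).
Proof. exact: computable_comp2 computable2_add. Qed.

Lemma computable2_mul : computable2 muln.
Proof.
apply: (computable2_rec (b := fun=> 0) (h := fun p _ r => p + r)).
- exact: computable_zero.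
- exact: (computable_add (computable_proj 0) (computable_proj 2)).
- by move=> p; rewrite muln0.
- by move=> p i; rewrite mulnS.
Qed.

Lemma computable_mul f g :
  computable f -> computable g -> computable (fun v => f v * g v).
Proof. exact: computable_comp2 computable2_mul. Qed.

Lemma computable2_exp : computable2 expn.
Proof.
apply: (computable2_rec (b := fun=> 1) (h := fun p _ r => p * r)).
- exact: computable_const.
- exact: (computable_mul (computable_proj 0) (computable_proj 2)).
- by move=> p; rewrite expn0.
- by move=> p i; rewrite expnS.
Qed.

Lemma computable_exp f g :
  computable f -> computable g -> computable (fun v => f v ^ g v).
Proof. exact: computable_comp2 computable2_exp. Qed.

Lemma computable2_sub : computable2 subn.
Proof.
apply: (computable2_rec (b := id) (h := fun _ _ r => r.-1)).
- exact: (computable_proj 0).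
- exact: (computable_comp1 computable1_pred (computable_proj 2)).
- by move=> p; rewrite subn0.
- by move=> p i; rewrite subnS.
Qed.

Lemma computable_sub f g :
  computable f -> computable g -> computable (fun v => f v - g v).
Proof. exact: computable_comp2 computable2_sub. Qed.

Lemma computable1_factorial : computable1 factorial.
Proof.
apply: (computable1_rec (h := fun i r => i.+1 * r)) => //.
  exact: (computable_mul (computable_succ (computable_proj 0))
                         (computable_proj 1)).
exact: computable_const.
Qed.

Lemma computable_eq f g :
  computable f -> computable g -> computable (fun v => f v == g v).
Proof.
move=> cf cg; apply: (@eq_computable (fun v => 1 - ((f v - g v) + (g v - f v)))).
  by move=> v; rewrite eqn_leq -!subn_eq0 -addn_eq0; case: (_ + _).
apply: computable_sub; first exact: computable_const.
by apply: computable_add; apply: computable_sub.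
Qed.

Lemma computable_orb (f g : seq nat -> bool) :
  computable f -> computable g -> computable (fun v => f v || g v).
Proof.
move=> cf cg; apply: (@eq_computable (fun v => 1 - (1 - (f v + g v)))).
  by move=> v; case: (f v); case: (g v).
do 2!(apply: computable_sub; first exact: computable_const).
exact: computable_add.
Qed.

Lemma computable_code_cons f (gs : seq (seq nat -> nat)) :
    computable f -> computable (fun v => CodeSeq.code [seq g v | g <- gs]) ->
  computable (fun v => CodeSeq.code [seq g v | g <- f :: gs]).
Proof.
move=> cf cgs; apply: computable_mul.
  by apply: computable_exp => //; apply: computable_const.
apply: computable_succ; apply: eq_computable (computable_add cgs cgs) => v.
by rewrite addnn.
Qed.

Lemma computable_code2 f1 f2 :
    computable f1 -> computable f2 ->
  computable (fun v => CodeSeq.code [:: f1 v; f2 v]).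
Proof.
move=> c1 c2; apply: (@computable_code_cons _ [:: f2]) => //.
by apply: (@computable_code_cons _ [::]) => //; apply: computable_zero.
Qed.

Lemma computable_code3 f1 f2 f3 :
    computable f1 -> computable f2 -> computable f3 ->
  computable (fun v => CodeSeq.code [:: f1 v; f2 v; f3 v]).
Proof.
move=> c1 c2 c3; apply: (@computable_code_cons _ [:: f2; f3]) => //.
exact: computable_code2.
Qed.

Lemma computable_code4 f1 f2 f3 f4 :
    computable f1 -> computable f2 -> computable f3 -> computable f4 ->
  computable (fun v => CodeSeq.code [:: f1 v; f2 v; f3 v; f4 v]).
Proof.
move=> c1 c2 c3 c4; apply: (@computable_code_cons _ [:: f2; f3; f4]) => //.
exact: computable_code3.
Qed.


Lemma eq_recursive_set (A B : nat -> Prop) :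
  (forall m, A m <-> B m) -> recursive_set A -> recursive_set B.
Proof. by move=> AB [b [cb bA]]; exists b; split=> // m; rewrite -AB. Qed.

Lemma recursive_setU (A B : nat -> Prop) :
    recursive_set A -> recursive_set B ->
  recursive_set (fun m => A m \/ B m).
Proof.
move=> [a [ca aA]] [b [cb bB]]; exists (fun m => a m || b m); split; last first.
  move=> m; split=> [[/aA->|/bB->]|/orP[/aA|/bB]]; rewrite ?orbT //.
    by left.
  by right.
have comp (f : pred nat) :
    recursive (fun v : 1.-tuple nat => nat_of_bool (f (thead v))) ->
    computable (fun v => f (nth 0 v 0)).
  move=> rf n; pose g (_ : 'I_1) (v : n.-tuple nat) := nth 0 v 0.
  apply: (recursive_comp (g := g) rf) => [i|v]; first exact: computable_proj.
  by rewrite /thead tnth_mktuple.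
apply: eq_recursive (computable_orb (comp _ ca) (comp _ cb) 1) => v.
by rewrite /thead (tnth_nth 0).
Qed.

Lemma recursive_set_pred (b : pred nat) :
  computable1 (fun m => b m) -> recursive_set b.
Proof.
move=> cb; exists b; split=> //.
by apply: eq_recursive (cb 1) => v; rewrite /thead (tnth_nth 0).
Qed.

Lemma recursive_set1 c : recursive_set (fun m => c = m).
Proof.
apply: (@eq_recursive_set (fun m => c == m)) => [m|]; first by split=> /eqP.
apply: recursive_set_pred; apply: computable_eq; last exact: computable_proj.
exact: computable_const.
Qed.

(** When the code of the [n]-th element is at least [n], membership of [m] can
    be decided by comparing [m] with the elements of index at most [m]. *)
Lemma recursive_set_codom (c : nat -> nat) :
    computable1 c -> (forall n, n <= c n) ->
  recursive_set (fun m => exists n, c n = m).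
Proof.
move=> cc le_c; pose f m k := has (fun n => c n == m) (iota 0 k).
apply: (@eq_recursive_set (fun m => f m m.+1)) => [m|].
  split=> [/hasP[n _ /eqP<-]|[n <-]]; first by exists n.
  by apply/hasP; exists n; rewrite ?mem_iota //= add0n ltnS.
apply: recursive_set_pred.
have cf : computable2 (fun m k => f m k).
  apply: (computable2_rec (b := fun=> 0)
            (h := fun m k r => (r == 1) || (c k == m))) => [||//|m k].
  - exact: computable_zero.
  - apply: computable_orb; apply: computable_eq.
    + exact: (computable_proj 2).
    + exact: computable_const.
    + exact: (computable_comp1 cc (computable_proj 1)).
    + exact: (computable_proj 0).
  - rewrite /f -addn1 iotaD has_cat /= add0n orbF.
    by case: has; case: eqP.
exact: (computable_comp2 cf (computable_proj 0)
                         (computable_succ (computable_proj 0))).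
Qed.

End Computability.

(** * The axioms *)

Section ACFC.

Local Open Scope nat_scope.

Implicit Types (s : Defs.sort) (phi : formula).

(** Quantifies over both sorts at once; a vacuous quantifier is harmless. *)
Fixpoint close k phi :=
  if k is k'.+1 then fForall Dom k' (fForall Cod k' (close k' phi)) else phi.

(** The polynomial with coefficients the variables [0], ..., [i], leading
    coefficient first, at the point given by the variable [d]. *)
Fixpoint horner_term s d i : term s :=
  if i is j.+1 then
    tAdd (tMul (horner_term s d j) (tVar s d)) (tVar s j.+1)
  else tVar s 0.

(** For [n = 0] this says that nonzero elements are invertible. *)
Definition closed_axiom s n :=
  close n.+2 (fExists s n.+2
    (fEq (tMul (tVar s 0) (horner_term s n.+2 n.+1)) (tZero s))).

(** The values of [chi] at invertible elements being nonzero, this amounts to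
    injectivity when the domain is a field. *)
Definition kernel_axiom :=
  close 1 (fImp (fEq (tChi (tVar Dom 0)) (tOne Cod))
                (fEq (tVar Dom 0) (tOne Dom))).

Fixpoint numeral c : term Cod :=
  if c is c'.+1 then tAdd (numeral c') (tOne Cod) else tZero Cod.

Fixpoint range_term j m : term Cod :=
  if m is m'.+1 then
    tMul (range_term j m')
         (tAdd (tMul (tVar Cod j) (tVar Cod j))
               (tOpp (tMul (numeral m) (numeral m))))
  else tOne Cod.

Fixpoint sum_term m i : term Cod :=
  if i is j.+1 then
    tAdd (sum_term m j) (tMul (tVar Cod j) (tChi (tVar Dom j)))
  else tVar Cod m.

Fixpoint power_term j N : term Dom :=
  if N is N'.+1 then tMul (power_term j N') (tVar Dom j) else tOne Dom.

Fixpoint unity_term N i : term Dom :=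
  if i is j.+1 then
    tMul (unity_term N j) (tAdd (power_term j N) (tOpp (tOne Dom)))
  else tOne Dom.

Fixpoint relation_formula m i :=
  if i is j.+1 then
    fImp (fEq (range_term j m) (tZero Cod)) (relation_formula m j)
  else fImp (fEq (sum_term m m) (tZero Cod))
            (fEq (unity_term (m.+1)`! m) (tZero Dom)).

(** If [y_0], ..., [y_m] are among the integers [1], [-1], ..., [m], [-m] and
    [y_m + y_0 * chi x_0 + ... + y_(m-1) * chi x_(m-1) = 0], then some [x_i] is
    a root of unity of order dividing [(m + 1)!], the bound that Mann's theorem
    gives for relations with at most [m + 1] terms.  A shorter relation is the
    special case where some of the [x_i] are [0], so that a single parameter
    bounds both the length and the coefficients.  With all the [x_i] equal to
    [0], the sentence also excludes positive characteristics. *)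
Definition mann_axiom m := close m.+1 (relation_formula m m.+1).

Definition acfc phi :=
  [\/ exists n, phi = closed_axiom Dom n, exists n, phi = closed_axiom Cod n,
      phi = kernel_axiom | exists m, phi = mann_axiom m].

Lemma formula_free_close s x k phi :
  formula_free s x (close k phi) -> formula_free s x phi /\ k <= x.
Proof.
elim: k => [//|k IHk] /= [nD [nC /IHk[phi_x le_kx]]]; split=> //.
rewrite ltn_neqAle le_kx andbT; apply/eqP=> eq_kx.
by case: s {IHk phi_x} nD nC; rewrite eq_kx.
Qed.

Lemma sentence_close k phi :
  (forall s x, formula_free s x phi -> x < k) -> sentence (close k phi).
Proof. by move=> lt_k s x /formula_free_close[/lt_k]; rewrite ltnNge => /negP. Qed.

Lemma forall_exists_close k phi :
  exists_prefix phi -> forall_exists (close k phi).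
Proof. by move=> ex; elim: k => [|k IHk] //=; case: phi ex. Qed.

Lemma term_free_horner s x s' d i :
  term_free s x (horner_term s' d i) -> s' = s /\ (x = d \/ x <= i).
Proof.
elim: i => [|i IHi] /=; first by case=> -> <-; split; [|right].
case=> [[/IHi[-> [->|le_xi]]|[-> <-]]|[-> <-]]; split=> //; try by [left | right].
by right; apply: leqW.
Qed.

Lemma closed_axiomP s n :
  sentence (closed_axiom s n) /\ forall_exists (closed_axiom s n).
Proof.
split; last exact: forall_exists_close.
apply: sentence_close => s' x [neq [free_x|//]].
case: (free_x : _ \/ term_free s' x (horner_term s n.+2 n.+1)).
  by case=> _ <-.
case/term_free_horner=> ss' [xn|]; last by rewrite ltnS.
by case: neq; rewrite ss' xn.
Qed.

Lemma kernel_axiomP : sentence kernel_axiom /\ forall_exists kernel_axiom.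
Proof.
split; last exact: forall_exists_close.
by apply: sentence_close => s x /= [[[_ <-]|]|[[_ <-]|]].
Qed.

Lemma term_free_numeral s x c : ~ term_free s x (numeral c).
Proof. by elim: c => [|c IHc] //= []. Qed.

Lemma term_free_range s x j m : term_free s x (range_term j m) -> x = j.
Proof.
elim: m => [//|m IHm] [//|/= [[[_ ->]|[_ ->]]|[|]] //].
- by case=> // /term_free_numeral.
- by case=> // /term_free_numeral.
Qed.

Lemma term_free_sum s x m i : term_free s x (sum_term m i) -> x = m \/ x < i.
Proof.
elim: i => [|i IHi] /=; first by case=> _ ->; left.
case=> [/IHi[->|lt_xi]|[[_ <-]|[_ <-]]]; [by left|right|by right|by right].
exact: leqW.
Qed.

Lemma term_free_power s x j N : term_free s x (power_term j N) -> x = j.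
Proof. by elim: N => [//|N IHN] /= [//|[_ ->]]. Qed.

Lemma term_free_unity s x N i : term_free s x (unity_term N i) -> x < i.
Proof.
by elim: i => [//|i IHi] /= [/IHi/leqW//|[/term_free_power->|//]].
Qed.

Lemma formula_free_relation s x m i :
  formula_free s x (relation_formula m i) -> x <= m \/ x < i.
Proof.
elim: i => [|i IHi] /=.
  case=> [[/term_free_sum[->|/ltnW]|//]|[/term_free_unity/ltnW|//]] //; by left.
case=> [[/term_free_range->|//]|/IHi[|/leqW]]; by [left | right].
Qed.

Lemma quantifier_free_relation m i : quantifier_free (relation_formula m i).
Proof. by elim: i. Qed.

Lemma mann_axiomP m : sentence (mann_axiom m) /\ forall_exists (mann_axiom m).
Proof.
split; last first.
  apply: forall_exists_close; have := quantifier_free_relation m m.+1.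
  by case: relation_formula.
by apply: sentence_close => s x /formula_free_relation[].
Qed.

(** * Codes of the axioms *)

Ltac computable_step :=
  first [ assumption
        | exact: computable_proj
        | exact: computable_const
        | apply: computable_code4 | apply: computable_code3
        | apply: computable_code2 | apply: computable_succ ].

Fixpoint close_code c k :=
  if k is k'.+1 then
    CodeSeq.code [:: 6; 0; k'; CodeSeq.code [:: 6; 1; k'; close_code c k']]
  else c.

Lemma formula_code_close k phi :
  formula_code (close k phi) = close_code (formula_code phi) k.
Proof. by elim: k => //= k ->. Qed.

Lemma computable_close : computable2 close_code.
Proof.
apply: (computable2_rec (b := id)
  (h := fun _ i r => CodeSeq.code [:: 6; 0; i; CodeSeq.code [:: 6; 1; i; r]]));
  by repeat computable_step.
Qed.

Lemma computable_horner s :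
  computable2 (fun d i => term_code (horner_term s d i)).
Proof.
pose c := sort_code s.
apply: (computable2_rec (b := fun=> CodeSeq.code [:: 0; c; 0])
  (h := fun d i r => CodeSeq.code [:: 3;
     CodeSeq.code [:: 5; r; CodeSeq.code [:: 0; c; d]];
     CodeSeq.code [:: 0; c; i.+1]])) => //;
  by repeat computable_step.
Qed.

Lemma computable_closed_axiom s :
  computable1 (fun n => formula_code (closed_axiom s n)).
Proof.
have c2 : computable (fun v => (nth 0 v 0).+2) by repeat computable_step.
have c1 : computable (fun v => (nth 0 v 0).+1) by repeat computable_step.
have ch := computable_comp2 (computable_horner s) c2 c1.
pose c := sort_code s.
apply: (@eq_computable (fun v => close_code (CodeSeq.code
  [:: 7; c; (nth 0 v 0).+2; CodeSeq.code [:: 1;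
     CodeSeq.code [:: 5; CodeSeq.code [:: 0; c; 0];
       term_code (horner_term s (nth 0 v 0).+2 (nth 0 v 0).+1)];
     CodeSeq.code [:: 1; c]]]) (nth 0 v 0).+2)).
  by move=> v; rewrite formula_code_close.
by apply: (computable_comp2 computable_close _ c2); repeat computable_step.
Qed.

Lemma computable_numeral : computable1 (fun c => term_code (numeral c)).
Proof.
apply: (computable1_rec
  (h := fun _ r => CodeSeq.code [:: 3; r; CodeSeq.code [:: 2; 1]])) => //;
  by repeat computable_step.
Qed.

Lemma computable_range : computable2 (fun j m => term_code (range_term j m)).
Proof.
pose num c := term_code (numeral c); pose var j := CodeSeq.code [:: 0; 1; j].
have cn := computable_comp1 computable_numeral
             (computable_succ (computable_proj 1)).
apply: (computable2_rec (b := fun=> CodeSeq.code [:: 2; 1])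
  (h := fun j m r => CodeSeq.code [:: 5; r; CodeSeq.code [:: 3;
     CodeSeq.code [:: 5; var j; var j];
     CodeSeq.code [:: 4; CodeSeq.code [:: 5; num m.+1; num m.+1]]]])) => //;
  by repeat computable_step.
Qed.

Lemma computable_sum : computable2 (fun m i => term_code (sum_term m i)).
Proof.
apply: (computable2_rec (b := fun m => CodeSeq.code [:: 0; 1; m])
  (h := fun _ i r => CodeSeq.code [:: 3; r;
     CodeSeq.code [:: 5; CodeSeq.code [:: 0; 1; i];
        CodeSeq.code [:: 6; CodeSeq.code [:: 0; 0; i]]]])) => //;
  by repeat computable_step.
Qed.

Lemma computable_power : computable2 (fun j N => term_code (power_term j N)).
Proof.
apply: (computable2_rec (b := fun=> CodeSeq.code [:: 2; 0])
  (h := fun j _ r => CodeSeq.code [:: 5; r; CodeSeq.code [:: 0; 0; j]])) => //;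
  by repeat computable_step.
Qed.

Lemma computable_unity : computable2 (fun N i => term_code (unity_term N i)).
Proof.
apply: (computable2_rec (b := fun=> CodeSeq.code [:: 2; 0])
  (h := fun N i r => CodeSeq.code [:: 5; r; CodeSeq.code [:: 3;
     term_code (power_term i N);
     CodeSeq.code [:: 4; CodeSeq.code [:: 2; 0]]]])) => //;
  repeat computable_step.
by apply: (computable_comp2 computable_power); repeat computable_step.
Qed.

Lemma computable_relation :
  computable2 (fun m i => formula_code (relation_formula m i)).
Proof.
apply: (computable2_rec
  (b := fun m => CodeSeq.code [:: 5;
     CodeSeq.code [:: 1; term_code (sum_term m m); CodeSeq.code [:: 1; 1]];
     CodeSeq.code [:: 1; term_code (unity_term (m.+1)`! m);
        CodeSeq.code [:: 1; 0]]])
  (h := fun m i r => CodeSeq.code [:: 5;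
     CodeSeq.code [:: 1; term_code (range_term i m); CodeSeq.code [:: 1; 1]];
     r])) => //; repeat computable_step.
- by apply: (computable_comp2 computable_sum); repeat computable_step.
- apply: (computable_comp2 computable_unity); last by repeat computable_step.
  by apply: (computable_comp1 computable1_factorial); repeat computable_step.
- by apply: (computable_comp2 computable_range); repeat computable_step.
Qed.

Lemma computable_mann_axiom : computable1 (fun m => formula_code (mann_axiom m)).
Proof.
apply: (@eq_computable (fun v => close_code
  (formula_code (relation_formula (nth 0 v 0) (nth 0 v 0).+1))
  (nth 0 v 0).+1)) => [v|]; first by rewrite formula_code_close.
apply: (computable_comp2 computable_close); last by repeat computable_step.
by apply: (computable_comp2 computable_relation); repeat computable_step.
Qed.

Lemma leq_formula_code_close k phi : k <= formula_code (close k.+1 phi).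
Proof.
by rewrite /=; case/and4P: (CodeSeq.ltn_code [:: 6; 0; k; formula_code
  (fForall Cod k (close k phi))]) => _ _ /ltnW.
Qed.

Lemma acfc_recursive : recursive_theory acfc.
Proof.
have rc s : recursive_set (fun m => exists n, formula_code (closed_axiom s n) = m).
  apply: recursive_set_codom => [|n]; first exact: computable_closed_axiom.
  exact: leq_trans (leq_formula_code_close n.+1 _).
have rm : recursive_set (fun m => exists n, formula_code (mann_axiom n) = m).
  apply: recursive_set_codom => [|n]; first exact: computable_mann_axiom.
  exact: leq_formula_code_close.
have r1 := recursive_set1 (formula_code kernel_axiom).
apply: eq_recursive_set
  (recursive_setU (recursive_setU (rc Dom) (rc Cod)) (recursive_setU r1 rm)).
move=> m; split.
- case=> [[]|[]] => [[n <-]|[n <-]|<-|[n <-]].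
  + by exists (closed_axiom Dom n) => //; constructor 1; exists n.
  + by exists (closed_axiom Cod n) => //; constructor 2; exists n.
  + by exists kernel_axiom => //; constructor 3.
  + by exists (mann_axiom n) => //; constructor 4; exists n.
- case=> _ [[n ->]|[n ->]|->|[n ->]] <-.
  + by do 2!left; exists n.
  + by left; right; exists n.
  + by right; left.
  + by do 2!right; exists n.
Qed.

Lemma acfc_sentence phi : acfc phi -> sentence phi /\ forall_exists phi.
Proof.
case=> [[n ->]|[n ->]|->|[m ->]].
- exact: closed_axiomP.
- exact: closed_axiomP.
- exact: kernel_axiomP.
- exact: mann_axiomP.
Qed.

End ACFC.

(** * Cyclotomic polynomials in characteristic zero *)

Section Cyclotomic.

Local Open Scope ring_scope.

Lemma intr_eq0_pchar0 (K : idomainType) (a : int) :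
  [pchar K] =i pred0 -> (a%:~R == 0 :> K) = (a == 0).
Proof.
move/pcharf0P=> charK; case: a => n; first exact: charK.
by rewrite NegzE rmorphN oppr_eq0 [_%:~R == 0]charK oppr_eq0.
Qed.

Lemma map_intr_Cyclotomic (K : fieldType) n (z : K) :
  n.-primitive_root z -> map_poly intr 'Phi_n = cyclotomic z n.
Proof.
elim/ltn_ind: n z => n IHn z prim_z; have n_gt0 := prim_order_gt0 prim_z.
pose q := \prod_(d <- rem n (divisors n)) 'Phi_d.
have [uDn _ inDn] := divisors_correct n_gt0.
have nz_q : map_poly (intr : int -> K) q != 0.
  have mon_q : q \is monic by apply: monic_prod => d _; apply: Cyclotomic_monic.
  exact: monic_neq0 (monic_map _ mon_q).
apply: (mulIf nz_q).
have Dn : map_poly (intr : int -> K) ('X^n - 1) = 'X^n - 1.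
  by rewrite rmorphB rmorph1 /= map_polyXn.
have DPhi : 'Phi_n * q = 'X^n - 1.
  by rewrite -prod_Cyclotomic // (big_rem n) ?inDn.
rewrite -rmorphM DPhi [LHS]Dn.
rewrite (prod_cyclotomic prim_z) (big_rem n) ?inDn //= divnn n_gt0 expr1.
congr (_ * _); rewrite rmorph_prod /=; apply: eq_big_seq => d.
rewrite mem_rem_uniq ?inE //= inDn => /andP[n'd ddvn].
apply/esym/IHn; last exact: dvdn_prim_root.
by rewrite ltn_neqAle n'd dvdn_leq.
Qed.

(** The greatest common divisor divides both polynomials up to nonzero integers,
    so that its roots in [algC] are common roots. *)
Lemma gcdp_common_root (p q : {poly int}) :
    (1 < size (gcdp p q))%N ->
  exists2 w : algC, root (map_poly intr p) w & root (map_poly intr q) w.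
Proof.
move=> gt1; set g := gcdp p q in gt1.
have nz_g : g != 0 by rewrite -size_poly_gt0 (ltn_trans _ gt1).
have /closed_rootP[w gw] : size (map_poly intr g : {poly algC}) != 1%N.
  by rewrite size_map_inj_poly //; [case: size gt1 => [|[]] | exact: intr_inj].
suffices dvd_root r : g %| r -> root (map_poly intr r) w.
  by exists w; apply: dvd_root; rewrite ?dvdp_gcdl ?dvdp_gcdr.
rewrite Pdiv.Idomain.dvdp_eq => /eqP/(congr1 (map_poly (intr : int -> algC))).
rewrite rmorphM map_polyZ /= => Dr; have := rootP gw; rewrite /root.
have /(congr1 (horner^~ w)) := Dr; rewrite hornerM hornerZ => Dw gw0.
move/eqP: Dw; rewrite gw0 mulr0 mulf_eq0 intr_eq0 expf_eq0 lead_coef_eq0.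
by rewrite (negPf nz_g) andbF.
Qed.

Lemma size_root_primitive_algC n (w : algC) (q : {poly int}) :
    n.-primitive_root w -> root (map_poly intr q) w -> q != 0 ->
  (size 'Phi_n <= size q)%N.
Proof.
move=> prim_w qw nz_q; have [p [Dp _ pP]] := minCpolyP w.
rewrite size_Cyclotomic -(size_cyclotomic w) -(minCpoly_cyclotomic prim_w) Dp.
rewrite size_map_poly.
rewrite -(size_map_inj_poly (intr_inj : injective (intr : int -> rat))) //.
apply: dvdp_leq; first by rewrite map_poly_eq0_id0 // intr_eq0 lead_coef_eq0.
rewrite -pP -map_poly_comp; congr (root _ w): qw.
by apply: eq_map_poly => a /=; rewrite ratr_int.
Qed.

(** The resultant of [q] and ['Phi_n] is an integer combination of both, hence
    vanishes at [z] and thus, in characteristic [0], is the integer [0].  So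
    [q] and ['Phi_n] have a common root in [algC], where the cyclotomic
    polynomial is the minimal polynomial of that root. *)
Lemma size_root_primitive (K : fieldType) n (z : K) (q : {poly int}) :
    [pchar K] =i pred0 -> n.-primitive_root z -> root (map_poly intr q) z ->
  q != 0 -> (size 'Phi_n <= size q)%N.
Proof.
move=> charK prim_z qz nz_q; have n_gt0 := prim_order_gt0 prim_z.
have Phi_z : root (map_poly intr 'Phi_n) z.
  by rewrite (map_intr_Cyclotomic prim_z) root_cyclotomic.
have size_gt1 (p : {poly int}) : p != 0 -> root (map_poly intr p) z ->
    (1 < size p)%N.
  move=> nz_p; apply: contraTT; rewrite -leqNgt => /size1_polyC Dp.
  move: nz_p; rewrite Dp polyC_eq0 map_polyC rootC /=.
  by rewrite intr_eq0_pchar0.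
have mon := Cyclotomic_monic n.
have [[u v] _ /=] := resultant_in_ideal (size_gt1 q nz_q qz)
  (size_gt1 _ (monic_neq0 mon) Phi_z).
move/(congr1 (fun p => (map_poly (intr : int -> K) p).[z])).
rewrite rmorphD !rmorphM /= map_polyC hornerC hornerD !hornerM.
rewrite (rootP qz) (rootP Phi_z) !mulr0 addr0 => /eqP.
rewrite [_ == 0](intr_eq0_pchar0 _ charK) resultant_eq0.
case/gcdp_common_root=> w qw; have [w0 prim_w0] := C_prim_root_exists n_gt0.
rewrite (map_intr_Cyclotomic prim_w0) root_cyclotomic // => prim_w.
exact: size_root_primitive_algC prim_w qw nz_q.
Qed.

(** An integral polynomial vanishing at one primitive root of unity is a
    multiple of the cyclotomic polynomial, hence vanishes at all of them. *)
Lemma root_primitive_conj (K : fieldType) n (z w : K) (q : {poly int}) :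
    [pchar K] =i pred0 -> n.-primitive_root z -> n.-primitive_root w ->
  root (map_poly intr q) z -> root (map_poly intr q) w.
Proof.
move=> charK prim_z prim_w; have mon := Cyclotomic_monic n.
have rootPhi x : n.-primitive_root x -> (map_poly intr 'Phi_n).[x] = 0 :> K.
  move=> prim_x; apply/rootP.
  by rewrite (map_intr_Cyclotomic prim_x) root_cyclotomic.
rewrite [q](Pdiv.RingMonic.rdivp_eq mon); set r := Pdiv.Ring.rmodp q _.
rewrite /root rmorphD rmorphM /= !hornerD !hornerM !rootPhi // !mulr0 !add0r.
have [-> _|nz_r rz] := eqVneq r 0; first by rewrite map_poly0 horner0.
have := size_root_primitive charK prim_z rz nz_r.
by rewrite leqNgt Pdiv.Ring.ltn_rmodpN0 // monic_neq0.
Qed.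

End Cyclotomic.

(** * Mann's theorem on relations between roots of unity *)

Section Mann.

Local Open Scope ring_scope.

(** The primes at which [m] fails to divide [n!] are those that the descent of
    Mann's theorem can remove. *)
Lemma big_prime_or_square n m :
    (0 < m)%N -> ~~ (m %| n`!)%N ->
  exists p, [/\ prime p, (p %| m)%N & (p %| m %/ p)%N || (n < p)%N].
Proof.
move=> m_gt0 ndvd; have /allPn[p] : ~~ all (fun p : nat => m`_p %| n`!)%N (primes m).
  by apply: contra ndvd => /allP dvd_m; apply/dvdn_partP.
rewrite mem_primes m_gt0 p_part => /andP[p_pr p_dvd] ndvd_p.
exists p; split=> //; rewrite orbC ltnNge -implybE; apply/implyP=> le_pn.
have := dvdn_leq_log p m_gt0 p_dvd; rewrite logn_prime // eqxx.
rewrite leq_eqVlt => /predU1P[log1|log2].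
  by case/negP: ndvd_p; rewrite -log1 dvdn_fact // prime_gt0.
rewrite -(@dvdn_pmul2r p) ?prime_gt0 // divnK // mulnn.
by rewrite pfactor_dvdn.
Qed.

(** All residues [t] modulo [p], except one if [p] does not divide [q], give an
    exponent [1 + t * q] that is prime to [q * p], that is, a conjugation of the
    [q * p]-th roots of unity which fixes the [q]-th ones. *)
Lemma conjugation_exponents p q :
    prime p ->
  exists ts : seq nat,
    [/\ uniq ts, all (ltn^~ p) ts,
        all (fun t => coprime (1 + t * q) (q * p)) ts
      & (p.-1 + (p %| q) <= size ts)%N].
Proof.
move=> p_pr; have p_gt0 := prime_gt0 p_pr.
have co_q t : coprime (1 + t * q) q.
  by rewrite coprime_sym addnC /coprime gcdnMDl gcdn1.
pose good t := coprime (1 + t * q) p.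
exists [seq t <- iota 0 p | good t]; split.
- by rewrite filter_uniq ?iota_uniq.
- by apply/allP=> t; rewrite mem_filter mem_iota => /andP[].
- by apply/allP=> t; rewrite mem_filter coprimeMr co_q => /andP[].
have [p_q|p'q] := boolP (p %| q)%N.
  rewrite (@eq_in_filter _ _ predT) ?filter_predT ?size_iota ?addn1 ?prednK //.
  by move=> t _; apply: coprime_dvdr p_q (co_q t).
rewrite addn0 size_filter.
have := count_predC good (iota 0 p); rewrite size_iota.
suffices : (count (predC good) (iota 0 p) <= 1)%N.
  by move: (count good _) (count _ _) => x y; lia.
rewrite -size_filter; have : uniq (filter (predC good) (iota 0 p)).
  by rewrite filter_uniq ?iota_uniq.
have : {in filter (predC good) (iota 0 p) &, forall t u, t = u}.
  have dvd_bad t : t \in filter (predC good) (iota 0 p) ->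
      (t < p)%N /\ (p %| 1 + t * q)%N.
    rewrite mem_filter mem_iota /= /good coprime_sym prime_coprime // negbK.
    by case/andP.
  move=> t u /dvd_bad[lt_t dvd_t] /dvd_bad[lt_u dvd_u].
  wlog le_ut : t u lt_t lt_u dvd_t dvd_u / (u <= t)%N => [th|].
    by case: (leqP u t) => [|/ltnW] le_; [|symmetry]; apply: th.
  have : (p %| (t - u) * q)%N by rewrite mulnBl -(subnDl 1) dvdn_sub.
  rewrite Euclid_dvdM // (negPf p'q) orbF => /dvdn_leq; lia.
case: filter => [|t [|u s]] // same /=.
by rewrite (same t u) ?inE ?eqxx ?orbT.
Qed.

(** Some class is not attained, and the shift makes it the top one.  This saves
    one degree when [p] does not divide [q] and one conjugation is missing. *)
Lemma avoid_last_residue (I : finType) (A : {set I}) (a : I -> nat) p :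
    (0 < p)%N -> (#|A| < p)%N ->
  exists s, forall i, i \in A -> ((a i + s) %% p < p.-1)%N.
Proof.
move=> p_gt0 ltAp; pose f i := Ordinal (ltn_pmod (a i) p_gt0).
have /subsetPn[e _ /imsetP Ne] : ~~ ([set: 'I_p] \subset f @: A).
  apply: contraL ltAp => /subset_leq_card; rewrite cardsT card_ord -leqNgt.
  by move/leq_trans; apply; apply: leq_imset_card.
exists (p.-1 - e)%N => i Ai; have lt_ep := ltn_ord e.
rewrite ltn_neqAle -ltnS prednK // ltn_pmod // andbT.
apply/eqP=> eq_i; case: Ne; exists i => //; apply: val_inj => /=.
have : a i + (p.-1 - e) = e + (p.-1 - e) %[mod p].
  by rewrite eq_i subnKC ?modn_small // -ltnS prednK.
by move/eqP; rewrite eqn_modDr [(e %% p)%N]modn_small // => /eqP.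
Qed.

(** Mann's theorem on rational relations between roots of unity, in the form
    that the ratio of any term to some other one has order dividing [n!].
    If [m] does not divide [n!], choose a prime [p] dividing [m] such that
    [p ^ 2] divides [m] or [p > n].  Group the terms by the residue of the
    exponent modulo [p]; the conjugations of the form [z |-> z * omega ^ t], with
    [omega] a primitive [p]-th root of unity, show that a polynomial whose coefficients
    are the sums over the groups has at least as many roots as its size.  So
    each group sums to [0], which is, up to a common factor, a relation between
    [m / p]-th roots of unity. *)
Lemma mann_roots_of_unity (K : fieldType) m (z : K) (I : finType) (A : {set I})
    (c : I -> int) (a : I -> nat) n i0 :
    [pchar K] =i pred0 -> m.-primitive_root z ->
    (#|A| <= n)%N -> i0 \in A -> (forall i, i \in A -> c i != 0) ->
    \sum_(i in A) (c i)%:~R * z ^+ a i = 0 ->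
  exists j, [/\ j \in A, j != i0 & z ^+ (a j * n`!) = z ^+ (a i0 * n`!)].
Proof.
move=> charK; elim/ltn_ind: m z A a => m IHm z A a prim_z leAn Ai0 nz_c sum0.
have m_gt0 := prim_order_gt0 prim_z.
have nz_z k : z ^+ k != 0.
  by rewrite expf_neq0 // (prim_root_eq0 prim_z) -lt0n.
have [dvd_m|] := boolP (m %| n`!)%N.
  (* All the terms are [n!]-th roots of unity: any other term will do. *)
  have [/exists_inP[j Aj ne_j]|] := boolP [exists j in A, j != i0].
    exists j; split=> //; rewrite ![(a _ * _)%N]mulnC.
    move: dvd_m; rewrite (prim_order_dvd prim_z) => /eqP zn.
    by rewrite !exprM zn !expr1n.
  rewrite negb_exists_in => /forall_inP single.
  move: sum0; rewrite (bigD1 i0) //= big1 => [|j /andP[Aj ne_j]].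
    rewrite addr0 => /eqP; rewrite mulf_eq0 (negPf (nz_z _)) orbF.
    by rewrite intr_eq0_pchar0 // (negPf (nz_c _ Ai0)).
  by case/negP: (single j Aj).
case/(big_prime_or_square m_gt0)=> p [p_pr p_dvd big_p].
have p_gt0 := prime_gt0 p_pr; pose q := (m %/ p)%N.
have Dm : m = (q * p)%N by rewrite divnK.
have [ts [uniq_ts lt_ts co_ts size_ts]] := conjugation_exponents q p_pr.
have [s lt_s] :
    exists s, forall i, i \in A -> ((a i + s) %% p < p.-1 + (p %| q)%N)%N.
  have [p_q|p'q] := boolP (p %| q)%N.
    by exists 0%N => i _; rewrite addn1 prednK ?ltn_pmod.
  have [||s sP] := @avoid_last_residue I A a p => //.
    by move: big_p; rewrite -/q (negPf p'q); apply: leq_ltn_trans.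
  by exists s => i; rewrite addn0; apply: sP.
pose w := z ^+ q; have prim_w : p.-primitive_root w.
  by have := dvdn_prim_root prim_z p_dvd.
(* The shift [s] keeps the degree of [Q] below the number of elements of [ts];
   it only changes the values at powers of [w] by invertible factors. *)
pose Q : {poly K} := \sum_(i in A) ((c i)%:~R * z ^+ a i) *: 'X^((a i + s) %% p).
have Q_root t : t \in ts -> root Q (w ^+ t).
  move/(allP co_ts)=> co_t; apply/rootP; rewrite horner_sum.
  pose r : {poly int} := \sum_(i in A) (c i) *: 'X^(a i).
  have rE x : (map_poly intr r).[x] = \sum_(i in A) (c i)%:~R * x ^+ a i :> K.
    rewrite rmorph_sum horner_sum; apply: eq_bigr => i _.
    by rewrite /= map_polyZ map_polyXn hornerZ hornerXn.
  have : root (map_poly intr r) (z ^+ (1 + t * q)).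
    apply: (root_primitive_conj charK prim_z); last by rewrite /root rE sum0.
    by rewrite prim_root_exp_coprime // Dm.
  rewrite /root rE => /eqP conj0.
  transitivity (w ^+ (t * s) *
    \sum_(i in A) (c i)%:~R * (z ^+ (1 + t * q)) ^+ a i); last first.
    by rewrite conj0 mulr0.
  rewrite mulr_sumr; apply: eq_bigr => i _.
  have wt1 : (w ^+ t) ^+ p = 1 by rewrite exprAC (prim_expr_order prim_w) expr1n.
  have -> : z ^+ (1 + t * q) = z * w ^+ t by rewrite add1n exprS (mulnC t) exprM.
  rewrite hornerZ hornerXn (expr_mod _ wt1) exprMn !exprD exprM.
  by rewrite -mulrA; ring.
have Q0 : Q = 0.
  apply/eqP; apply/negP=> /negP nzQ.
  have all_root : all (root Q) [seq w ^+ t | t <- ts].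
    by apply/allP=> _ /mapP[t ts_t ->]; apply: Q_root.
  have uniq_root : uniq [seq w ^+ t | t <- ts].
    rewrite map_inj_in_uniq // => t u /(allP lt_ts) lt_t /(allP lt_ts) lt_u.
    by move/eqP; rewrite (eq_prim_root_expr prim_w) !modn_small // => /eqP.
  have := max_poly_roots nzQ all_root uniq_root; rewrite size_map ltnNge => /negP.
  case; apply: leq_trans size_ts; apply: leq_trans (size_sum _ _ _) _.
  apply/bigmax_leqP => i /lt_s; apply: leq_trans.
  by rewrite (leq_trans (size_scale_leq _ _)) ?size_polyXn.
pose A' := [set i in A | (a i == a i0 %[mod p])%N].
pose b i := (a i %/ p)%N; pose r := (a i0 %% p)%N.
have Da i : i \in A' -> a i = (p * b i + r)%N.
  rewrite inE => /andP[_ /eqP eq_i].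
  by rewrite {1}(divn_eq (a i) p) mulnC eq_i.
have q_gt0 : (0 < q)%N by rewrite -(ltn_pmul2r p_gt0) -Dm mul0n.
have [||||||j [A'j ne_j zj]] := IHm q _ (z ^+ p) A' b.
- by rewrite Dm ltn_Pmulr ?prime_gt1.
- have /(dvdn_prim_root prim_z) : (q %| m)%N by rewrite Dm dvdn_mulr.
  by rewrite Dm mulKn.
- apply: leq_trans leAn; apply: subset_leq_card.
  by apply/subsetP=> i; rewrite inE => /andP[].
- by rewrite inE Ai0 eqxx.
- by move=> i; rewrite inE => /andP[/nz_c].
- apply: (mulfI (nz_z r)); rewrite mulr0 mulr_sumr.
  have /(congr1 (fun P : {poly K} => P`_((a i0 + s) %% p))) := Q0.
  rewrite coef0 coef_sum => sumA'; rewrite -[RHS]sumA'.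
  rewrite [RHS](eq_bigr (fun i => if (a i == a i0 %[mod p])%N then
    (c i)%:~R * z ^+ a i else 0)) => [|i _].
    rewrite -big_mkcondr /=; apply: eq_big => [i|i A'i]; first by rewrite inE.
    by rewrite (Da i A'i) exprD exprM mulrCA [z ^+ r * _]mulrC.
  rewrite coefZ coefXn eqn_modDr eq_sym.
  by case: eqP; rewrite (mulr1, mulr0).
have A'sub : j \in A by move: A'j; rewrite inE => /andP[].
exists j; split=> //.
have Dz i : i \in A' ->
    z ^+ (a i * n`!) = (z ^+ p) ^+ (b i * n`!) * z ^+ (r * n`!).
  by move/Da->; rewrite mulnDl exprD -mulnA exprM.
by rewrite !Dz ?zj // inE Ai0 eqxx.
Qed.

End Mann.

(** * Algebraic independence over cyclotomic extensions *)

Section CyclotomicLinearDisjointness.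

Local Open Scope ring_scope.

Variables (K : fieldType) (m r : nat) (z : K).
Hypotheses (charK : [pchar K] =i pred0) (prim_z : m.-primitive_root z).

(** The other [r] variables are kept inside the coefficients, so that a
    resultant with respect to the variable specialized at [z] is again a
    polynomial in them. *)
Let spec (A : {poly {mpoly int[r]}}) : {mpoly K[r]} :=
  (map_poly (map_mpoly intr) A).[z%:MP].

Let specD A B : spec (A + B) = spec A + spec B.
Proof. by rewrite /spec rmorphD hornerD. Qed.

Let specM A B : spec (A * B) = spec A * spec B.
Proof. by rewrite /spec rmorphM hornerM. Qed.

Let specC P : spec P%:P = map_mpoly intr P.
Proof. by rewrite /spec map_polyC hornerC. Qed.

Let Phi : {poly {mpoly int[r]}} := map_poly (@mpolyC r int) 'Phi_m.

Let specPhi : spec Phi = 0.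
Proof.
rewrite /spec /Phi -map_poly_comp.
rewrite (@eq_map_poly _ _ _ (@mpolyC r K \o intr)) => [|a]; last first.
  by rewrite /= map_mpolyC.
rewrite map_poly_comp horner_map /= (map_intr_Cyclotomic prim_z).
by rewrite (rootP _) ?mpolyC0 // root_cyclotomic.
Qed.

Let mpolyC_inj : injective (@mpolyC r int).
Proof. exact: can_inj (@mpolyCK r int). Qed.

Let size_Phi : size Phi = size 'Phi_m.
Proof. by rewrite (size_map_inj_poly mpolyC_inj). Qed.

Let map_mpoly_intr_eq0 (P : {mpoly int[r]}) :
  map_mpoly intr P = 0 :> {mpoly K[r]} -> P = 0.
Proof.
move=> P0; apply/mpolyP=> k; apply/eqP; rewrite mcoeff0.
by rewrite -(intr_eq0_pchar0 _ charK) -mcoeff_map_mpoly P0 mcoeff0.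
Qed.

(** This reduces, coefficient by coefficient, to the minimality of the
    cyclotomic polynomial. *)
Let spec_small (W : {poly {mpoly int[r]}}) :
  W != 0 -> (size W < size 'Phi_m)%N -> spec W != 0.
Proof.
move=> nzW ltW; apply/eqP=> W0.
have [k nz_k] : exists k, (lead_coef W)@_k != 0.
  apply/not_existsP => all0; case/eqP: nzW; apply/eqP; rewrite -lead_coef_eq0.
  by apply/eqP/mpolyP=> k; apply/eqP/negPn/negP; rewrite mcoeff0; apply: all0.
pose q := map_poly (mcoeff k) W.
have qE i : q`_i = (W`_i)@_k by rewrite coef_map.
have nzq : q != 0.
  by apply: contraNneq nz_k => q0; rewrite lead_coefE -qE q0 coef0.
have : (size 'Phi_m <= size q)%N.
  apply: (size_root_primitive charK prim_z) nzq; apply/eqP.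
  rewrite -(mcoeff0 K k) -W0 /spec (@horner_coef_wide _ (size W)); last first.
    exact: leq_trans (size_poly _ _) (size_poly _ _).
  rewrite (@horner_coef_wide _ (size W)); last exact: size_poly.
  rewrite raddf_sum /=; apply: eq_bigr => i _.
  rewrite !coef_map /= -rmorphXn /= mulrC [in RHS]mulrC mcoeffCM.
  by rewrite mcoeff_map_mpoly.
by rewrite leqNgt (leq_ltn_trans _ ltW) // size_poly.
Qed.

(** A point which is algebraically independent over the prime field remains so
    over its cyclotomic extension by [z].  Indeed the resultant of [A] and the
    cyclotomic polynomial vanishes at [y], hence is [0].  So the two have a
    common factor [g], and a constant multiple of [A * (Phi %/ g)] is a multiple
    of [Phi], where [Phi %/ g] is too short to be killed by [spec]. *)
Lemma spec_eq0 (y : 'I_r -> K) (A : {poly {mpoly int[r]}}) :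
    (forall P : {mpoly int[r]}, (map_mpoly intr P).@[y] = 0 -> P = 0) ->
  (spec A).@[y] = 0 -> spec A = 0.
Proof.
move=> indep Ay; have mon := Cyclotomic_monic m.
have [/size1_polyC DA|gtA] := leqP (size A) 1.
  by move: Ay; rewrite DA specC => /indep ->; rewrite raddf0.
have gtPhi : (1 < size Phi)%N.
  by rewrite size_Phi size_Cyclotomic ltnS totient_gt0 (prim_order_gt0 prim_z).
have [[u v] _ /= /(congr1 spec)] := resultant_in_ideal gtA gtPhi.
rewrite specC specD !specM specPhi mulr0 addr0.
move/(congr1 (meval y)); rewrite mevalM Ay mulr0 => /indep/eqP.
rewrite resultant_eq0; set g := gcdp A Phi => gt_g.
have nz_g : g != 0 by rewrite -size_poly_gt0 (ltn_trans _ gt_g).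
have [g_A g_Phi] : g %| A /\ g %| Phi by rewrite dvdp_gcdl dvdp_gcdr.
move: g_A g_Phi; rewrite !Pdiv.Idomain.dvdp_eq => /eqP DA /eqP DPhi.
set cA := _ ^+ _ in DA; set cP := _ ^+ _ in DPhi; set W := Phi %/ g in DPhi.
have [nz_cA nz_cP] : cA != 0 /\ cP != 0 by rewrite !expf_neq0 ?lead_coef_eq0.
have nz_Phi : Phi != 0 by rewrite -size_poly_gt0 (ltn_trans _ gtPhi).
have nzW : W != 0.
  apply: contraNneq nz_Phi => W0; move: DPhi; rewrite W0 mul0r => /eqP.
  by rewrite scale_poly_eq0 (negPf nz_cP).
have ltW : (size W < size 'Phi_m)%N.
  rewrite -size_Phi -(size_scale Phi nz_cP) DPhi size_mul //.
  by move: gt_g; case: (size g) => [|[|k]] // _; rewrite !addnS /= ltnS leq_addr.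
have : spec cA%:P * spec A * spec W = 0.
  rewrite -!specM mul_polyC DA -mulrA [g * W]mulrC -DPhi -mul_polyC !specM.
  by rewrite specPhi !mulr0.
move/eqP; rewrite !mulf_eq0 (negPf (spec_small nzW ltW)) orbF specC.
by case/orP=> /eqP // /map_mpoly_intr_eq0/eqP; rewrite (negPf nz_cA).
Qed.

(** Hence the monomials in [y] are linearly independent over the cyclotomic
    extension. *)
Lemma sum_monomial_class (y : 'I_r -> K) (I : finType) (A : {set I})
    (c : I -> int) (a : I -> nat) (e : I -> 'X_{1..r}) k :
    (forall P : {mpoly int[r]}, (map_mpoly intr P).@[y] = 0 -> P = 0) ->
    \sum_(i in A) (c i)%:~R * z ^+ a i * \prod_(l < r) y l ^+ e i l = 0 ->
  \sum_(i in A | e i == k) (c i)%:~R * z ^+ a i = 0.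
Proof.
move=> indep sum0.
pose B : {poly {mpoly int[r]}} := \sum_(i in A) (c i *: 'X_[e i]) *: 'X^(a i).
have DB : spec B = \sum_(i in A) ((c i)%:~R * z ^+ a i) *: 'X_[e i].
  rewrite /spec raddf_sum horner_sum; apply: eq_bigr => i _ /=.
  rewrite map_polyZ map_polyXn hornerZ hornerXn -rmorphXn /= map_mpolyZ /=.
  by rewrite map_mpolyX mulrC mul_mpolyC scalerA mulrC.
have /(spec_eq0 indep) : (spec B).@[y] = 0.
  rewrite DB raddf_sum -[RHS]sum0; apply: eq_bigr => i _.
  by rewrite /= mevalZ mevalX.
rewrite DB => /(congr1 (mcoeff k)); rewrite mcoeff0 raddf_sum /= => sumk.
rewrite -[RHS]sumk big_mkcondr; apply: eq_bigr => i _ /=.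
by rewrite mcoeffZ mcoeffX; case: eqP; rewrite (mulr1, mulr0).
Qed.

End CyclotomicLinearDisjointness.

(** * Relations between the values of a generic character *)

Section MultiplicativeBasis.

Local Open Scope ring_scope.

Variable F : idomainType.

Definition monomial n (alpha : n.-tuple F) (k : n.-tuple nat) : F :=
  \prod_(i < n) tnth alpha i ^+ tnth k i.

Lemma monomialM n (alpha : n.-tuple F) k l :
  monomial alpha k * monomial alpha l =
  monomial alpha [tuple (tnth k i + tnth l i)%N | i < n].
Proof.
rewrite -big_split /=; apply: eq_bigr => i _.
by rewrite tnth_mktuple exprD.
Qed.

Lemma monomial_neq0 n (alpha : n.-tuple F) k :
  (forall i, tnth alpha i != 0) -> monomial alpha k != 0.
Proof. by move=> nz; apply/prodf_neq0=> i _; rewrite expf_neq0. Qed.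

Lemma monomial_cons n a (alpha : n.-tuple F) e (k : n.-tuple nat) :
  monomial [tuple of a :: alpha] [tuple of e :: k] = a ^+ e * monomial alpha k.
Proof.
rewrite /monomial big_ord_recl !tnth0; congr (_ * _).
by apply: eq_bigr => i _; rewrite !tnthS.
Qed.

Lemma monomial_root n (alpha beta : n.-tuple F) d k :
    (forall i, tnth beta i ^+ d = tnth alpha i) ->
  monomial alpha k = monomial beta k ^+ d.
Proof.
move=> Dalpha; rewrite /monomial -prodrXl; apply: eq_bigr => i _.
by rewrite exprAC Dalpha.
Qed.

Lemma monomialX n (alpha : n.-tuple F) d k :
  monomial alpha k ^+ d = monomial alpha [tuple (d * tnth k i)%N | i < n].
Proof.
rewrite /monomial -prodrXl; apply: eq_bigr => i _.
by rewrite tnth_mktuple mulnC exprM.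
Qed.

Lemma mult_independent_monomial n (alpha : n.-tuple F) k l :
  mult_independent alpha -> monomial alpha k = monomial alpha l -> k = l.
Proof.
by move=> indep eq_kl; apply/eqP/negPn/negP => /eqP ne; apply: indep; exists k, l.
Qed.

Hypothesis closedF : alg_closed_field F.

Lemma alg_closed_root d (a : F) : (0 < d)%N -> exists b : F, b ^+ d = a.
Proof.
move=> d_gt0; case: closedF => _.
case/(_ d (fun i => if i == 0%N then a else 0) d_gt0) => b Db; exists b; rewrite Db.
case: d d_gt0 {Db} => // d _.
rewrite big_ord_recl big1 /= ?expr0 ?mulr1 ?addr0 // => i _.
by rewrite mul0r.
Qed.

(** Up to roots of unity and a common monomial factor, finitely many nonzero
    elements of an algebraically closed field are monomials in a
    multiplicatively independent tuple.  An element which depends on the tuple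
    found so far satisfies [x ^ d * gamma ^ k = gamma ^ l] with [d > 0], and it
    is enough to replace the entries of the tuple by [d]-th roots. *)
Lemma multiplicative_basis (xs : seq F) :
    (forall x, x \in xs -> x != 0) ->
  exists r (gamma : r.-tuple F) M D,
    [/\ (0 < D)%N, forall i, tnth gamma i != 0, mult_independent gamma
      & forall x, x \in xs -> exists tau e,
          tau ^+ D = 1 /\ monomial gamma M * x = tau * monomial gamma e].
Proof.
elim: xs => [|x xs IHxs] nz_xs.
  exists 0%N, [tuple], [tuple], 1%N; split=> // [[]//|[k [l []]]].
  by rewrite (tuple0 k) (tuple0 l).
have [|r [gamma [M [D [D_gt0 nz_gamma indep xsP]]]]] := IHxs.
  by move=> y xs_y; rewrite nz_xs // inE xs_y orbT.
have nz_x : x != 0 by rewrite nz_xs ?mem_head.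
have [[k0 [l0 [ne0 eq0]]]|indep_x] :=
    pselect (mult_dependent [tuple of x :: gamma]).
  have {k0 l0 ne0 eq0} [d [k [l [d_gt0 Dx]]]] : exists d k l,
      (0 < d)%N /\ x ^+ d * monomial gamma k = monomial gamma l.
    have : monomial [tuple of x :: gamma] k0 = monomial [tuple of x :: gamma] l0.
      exact: eq0.
    move: ne0 {eq0}; case/tupleP: k0 => k0 k; case/tupleP: l0 => l0 l.
    wlog le_lk : k0 k l0 l / (l0 <= k0)%N => [th ne0 eq0|].
      have [le|/ltnW le] := leqP l0 k0; first exact: th ne0 eq0.
      by apply: th le _ (esym eq0) => eq_kl; apply: ne0.
    rewrite !monomial_cons => ne0.
    rewrite -{1}(subnKC le_lk) exprD -mulrA.
    move/(mulfI (expf_neq0 _ nz_x)) => eq_l.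
    exists (k0 - l0)%N, k, l; split=> //; rewrite lt0n; apply/eqP => d0.
    apply: ne0; move: eq_l; rewrite d0 expr0 mul1r.
    by move/(mult_independent_monomial indep) => ->; rewrite -(subnKC le_lk) d0 addn0.
  (* With [d]-th roots as new entries, [x] times a monomial is a monomial up to
     the factor [tau], whose [d]-th power is [1]. *)
  have [root rootP] := choice (fun a => alg_closed_root a d_gt0).
  pose delta := map_tuple root gamma.
  have Dgamma i : tnth delta i ^+ d = tnth gamma i by rewrite tnth_map rootP.
  have nz_delta i : tnth delta i != 0.
    by have := nz_gamma i; rewrite -Dgamma expf_eq0 d_gt0.
  have mon_gamma e := monomial_root e Dgamma.
  pose tau := x * monomial delta k / monomial delta l.
  have unit_l : monomial delta l \is a GRing.unit.
    by case: closedF => fieldF _; apply/fieldF/monomial_neq0.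
  have tau_d : tau ^+ d = 1.
    by rewrite exprMn exprVn exprMn -!mon_gamma Dx divrr // mon_gamma unitrX.
  exists r, delta,
    [tuple (tnth [tuple (d * tnth M i)%N | i < r] i + tnth k i)%N | i < r],
    (D * d)%N.
  split=> // [|[k' [l' [ne eq_kl]]]|y].
  - by rewrite muln_gt0 D_gt0.
  - apply: indep; exists k', l'; split=> //.
    have := congr1 (fun a => a ^+ d) (eq_kl : monomial delta k' = monomial delta l').
    by rewrite -!mon_gamma.
  rewrite inE -monomialM -monomialX -mon_gamma => /predU1P[->|/xsP].
    exists tau,
      [tuple (tnth l i + tnth [tuple (d * tnth M i)%N | i < r] i)%N | i < r].
    split; first by rewrite mulnC exprM tau_d expr1n.
    rewrite -monomialM -monomialX -mon_gamma [RHS]mulrA divrK //.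
    by rewrite mulrC mulrA mulrAC.
  case=> [t [e [tD Dy]]].
  exists t,
    [tuple (tnth [tuple (d * tnth e i)%N | i < r] i + tnth k i)%N | i < r].
  split; first by rewrite exprM tD expr1n.
  by rewrite -monomialM -monomialX -mon_gamma mulrAC Dy mulrA.
exists r.+1, [tuple of x :: gamma], [tuple of 0%N :: M], D.
split=> // [i|y]; first by case: (unliftP ord0 i) => [j|] ->; rewrite ?tnthS.
rewrite inE monomial_cons expr0 mul1r => /predU1P[->|/xsP[t [e [tD Dy]]]].
  exists 1, [tuple of 1%N :: M]; split; first by rewrite expr1n.
  by rewrite monomial_cons expr1 mul1r mulrC.
by exists t, [tuple of 0%N :: e]; rewrite monomial_cons expr0 mul1r.
Qed.

End MultiplicativeBasis.

Section GenericRelations.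

Local Open Scope ring_scope.

Lemma alg_closed_primitive_root (K : idomainType) D :
    alg_closed_field K -> [pchar K] =i pred0 -> (0 < D)%N ->
  exists z : K, D.-primitive_root z.
Proof.
case=> fieldK closedK charK D_gt0.
(* The bundled structures provide the splitting of [X ^ D - 1]. *)
pose isF := GRing.ComUnitRing_isField.Build K fieldK.
pose Kf : fieldType := HB.pack (K : Type) (GRing.IntegralDomain.class K) isF.
pose isC := Field_isAlgClosed.Build Kf closedK.
pose L : closedFieldType := HB.pack (Kf : Type) (GRing.Field.class Kf) isC.
have [rs Drs] := closed_field_poly_normal ('X^D - 1 : {poly L}).
have := @separable_Xn_sub_1 L D; rewrite Drs lead_coefXnsubC // scale1r.
rewrite separable_prod_XsubC => sepD.
have uniq_rs : uniq rs.
  by rewrite sepD //; move/pcharf0P: charK => ->; rewrite -lt0n.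
have rs_unity : all D.-unity_root rs.
  apply/allP=> x rs_x; rewrite unity_rootE -subr_eq0.
  have : root ('X^D - 1) x by rewrite Drs lead_coefXnsubC // scale1r root_prod_XsubC.
  by rewrite /root !hornerE.
have size_rs : (D <= size rs)%N.
  rewrite -ltnS -(size_prod_XsubC rs id) -(@size_XnsubC L D 1) // Drs.
  by rewrite lead_coefXnsubC // scale1r.
have /hasP[z _ prim_z] := has_prim_root D_gt0 rs_unity uniq_rs size_rs.
by exists z.
Qed.

(** Integers lie in every subfield, so that genericity applies to polynomials
    with integer coefficients.  Stated for all [r], including [0]. *)
Lemma generic_algebraic_independence (F K : idomainType) (chi : F -> K) r
    (gamma : r.-tuple F) (P : {mpoly int[r]}) :
    [pchar K] =i pred0 -> generic chi -> mult_independent gamma ->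
    (map_mpoly intr P).@[fun i => tofrac (chi (tnth gamma i))] = 0 ->
  P = 0.
Proof.
move=> charK [_ gen] indep P0.
have intK (a : int) : (a%:~R == 0 :> {fraction K}) = (a == 0).
  by rewrite -(rmorph_int (@tofrac K)) tofrac_eq0 intr_eq0_pchar0.
suffices P0' : map_mpoly intr P = 0 :> {mpoly {fraction K}[r]}.
  apply/mpolyP=> k; apply/eqP; rewrite mcoeff0 -intK -mcoeff_map_mpoly P0'.
  by rewrite mcoeff0.
case: r gamma P P0 indep => [|r] gamma P P0 indep.
  by move: P0; rewrite [P]nvar0_mpolyC map_mpolyC mevalC => ->; rewrite mpolyC0.
apply: (gen r.+1 gamma isT indep) => [k S [S1 SB _]|]; last first.
  by rewrite -[RHS]P0; apply: meval_eq => i; rewrite tnth_mktuple.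
rewrite mcoeff_map_mpoly /=.
have S0 : 0 \in S by rewrite -(subrr 1) SB.
have Sn n : n%:R \in S.
  by elim: n => // n Sn; rewrite -[n.+1]addn1 natrD -[1%:R]opprK SB // -sub0r SB.
case: P@_k => n; first exact: Sn.
by rewrite NegzE mulrNz -sub0r SB //; apply: Sn.
Qed.

(** Write the [x i], up to a common factor, as roots of unity times monomials
    in a multiplicatively independent tuple.  Its image is algebraically
    independent even over the roots of unity, so that the terms with the same
    monomial as [x i0] already sum to [0]; these are a relation between roots of
    unity. *)
Lemma generic_relation (F K : idomainType) (chi : F -> K) (I : finType)
    (A : {set I}) (c : I -> int) (x : I -> F) n i0 :
    is_character chi -> alg_closed_field F -> alg_closed_field K ->
    [pchar K] =i pred0 -> generic chi ->
    (#|A| <= n)%N -> i0 \in A -> (forall i, i \in A -> c i != 0) ->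
    (forall i, i \in A -> x i != 0) ->
    \sum_(i in A) (c i)%:~R * chi (x i) = 0 ->
  exists j, [/\ j \in A, j != i0 & x j ^+ n`! = x i0 ^+ n`!].
Proof.
move=> [chiM chi0 chi1] closedF closedK charK gen leAn Ai0 nz_c nz_x sum0.
have chiX a k : chi (a ^+ k) = chi a ^+ k.
  by elim: k => [|k IHk]; rewrite ?expr0 // !exprS chiM IHk.
have [|r [gamma [M [D [D_gt0 nz_gamma indep xsP]]]]] :=
    @multiplicative_basis F closedF [seq x i | i in A].
  by move=> _ /imageP[i Ai ->]; apply: nz_x.
have /choice[te teP] (i : I) : exists te : F * r.-tuple nat, i \in A ->
    te.1 ^+ D = 1 /\ monomial gamma M * x i = te.1 * monomial gamma te.2.
  have [Ai|] := boolP (i \in A); last by exists (1, M).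
  by have [|t [e te]] := xsP (x i); [apply: image_f | exists (t, e)].
have [zK primK] := alg_closed_primitive_root closedK charK D_gt0.
pose z : {fraction K} := tofrac zK.
have prim_z : D.-primitive_root z.
  have prim_div d : (z ^+ d == 1) = (zK ^+ d == 1).
    by rewrite -rmorphXn -(rmorph1 (@tofrac K)) tofrac_eq.
  have [d prim_d dvd_d] := prim_order_exists D_gt0 (eqP (etrans (prim_div D)
    (introT eqP (prim_expr_order primK)))).
  suffices -> : D = d by [].
  apply/eqP; rewrite eqn_dvd dvd_d andbT (prim_order_dvd primK) -prim_div.
  by rewrite -(prim_order_dvd prim_d).
have /choice[a aP] (i : I) : exists a, i \in A -> tofrac (chi (te i).1) = z ^+ a.
  have [Ai|] := boolP (i \in A); last by exists 0%N.
  have [|a ->] := @prim_rootP _ _ _ prim_z (tofrac (chi (te i).1)).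
    by rewrite -rmorphXn -chiX (teP i Ai).1 chi1 rmorph1.
  by exists a.
pose y (l : 'I_r) : {fraction K} := tofrac (chi (tnth gamma l)).
pose e i := [multinom tnth (te i).2 l | l < r].
have mon_e i : tofrac (chi (monomial gamma (te i).2)) = \prod_(l < r) y l ^+ e i l.
  rewrite (big_morph chi chiM chi1) (rmorph_prod (@tofrac K)) /=.
  by apply: eq_bigr => l _; rewrite chiX rmorphXn mnmE.
have charE : [pchar {fraction K}] =i pred0.
  apply/pcharf0P=> k; rewrite -(rmorph_nat (@tofrac K)) tofrac_eq0.
  by move/pcharf0P: charK => ->.
have indep_y (P : {mpoly int[r]}) : (map_mpoly intr P).@[y] = 0 -> P = 0.
  exact: generic_algebraic_independence.
have sum_y : \sum_(i in A) (c i)%:~R * z ^+ a i * \prod_(l < r) y l ^+ e i l = 0.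
  transitivity (tofrac (chi (monomial gamma M)) *
    tofrac (\sum_(i in A) (c i)%:~R * chi (x i)) : {fraction K}); last first.
    by rewrite sum0 rmorph0 mulr0.
  rewrite rmorph_sum mulr_sumr; apply: eq_bigr => i Ai.
  rewrite -aP // -mon_e rmorphM /= rmorph_int -mulrA -rmorphM -chiM.
  by rewrite -(teP i Ai).2 chiM rmorphM mulrCA.
have sumA' := sum_monomial_class charE prim_z (e i0) indep_y sum_y.
pose A' := [set i in A | e i == e i0].
have [||||j [A'j ne_j zj]] :=
    @mann_roots_of_unity _ _ z I A' c a n i0 charE prim_z.
- apply: leq_trans leAn; apply: subset_leq_card.
  by apply/subsetP=> i; rewrite inE => /andP[].
- by rewrite inE Ai0 eqxx.
- by move=> i; rewrite inE => /andP[/nz_c].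
- by rewrite -[RHS]sumA'; apply: eq_bigl => i; rewrite inE.
have [Aj /eqP eq_e] : j \in A /\ e j == e i0.
  by move: A'j; rewrite inE => /andP[].
exists j; split=> //; set N := n`!.
have eq_e2 : (te j).2 = (te i0).2.
  apply: eq_from_tnth => l.
  by have := congr1 (fun k : 'X_{1..r} => k l) eq_e; rewrite !mnmE.
have eq_tau : (te j).1 ^+ N = (te i0).1 ^+ N.
  apply: gen.1; rewrite !chiX; apply/eqP; rewrite -tofrac_eq; apply/eqP.
  by rewrite !rmorphXn /= !aP // -!exprM.
apply: (mulfI (expf_neq0 N (monomial_neq0 M nz_gamma))).
by rewrite -!exprMn (teP j Aj).2 (teP i0 Ai0).2 !exprMn eq_tau eq_e2.
Qed.

End GenericRelations.

(** * The meaning of the axioms in a structure *)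

Section Semantics.

Local Open Scope ring_scope.

Lemma update_same (M : structure) (e : assignment M) s x a :
  update e x a s x = a.
Proof. by case: s a => a /=; rewrite eqxx. Qed.

Lemma update_other (M : structure) (e : assignment M) s x a s' y :
  y != x -> @update M e s x a s' y = e s' y.
Proof. by case: s a => a; case: s' => //= /negPf ->. Qed.

(** As [a] fixes the values of all the variables below [k], universal closure
    can be used without any statement on the free variables of [phi]. *)
Lemma sat_close (M : structure) (e : assignment M) k phi :
    sat e (close k phi) ->
  forall a : assignment M, exists e', (forall s i, (i < k)%N -> e' s i = a s i) /\
    sat e' phi.
Proof.
move=> + a; suffices : sat e (close k phi) -> exists e' : assignment M,
    [/\ forall s i, (i < k)%N -> e' s i = a s i,
        forall s i, (k <= i)%N -> e' s i = e s i & sat e' phi].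
  by move=> th /th[e' [eq_a _ sat_e']]; exists e'.
elim: k e => [|k IHk] e /=; first by exists e; split.
move=> /(_ (a Dom k))/(_ (a Cod k))/IHk[e' [eq_a eq_e sat_e']].
exists e'; split=> // s i; last first.
  by move=> lt_ki; rewrite eq_e 1?ltnW //; case: s; rewrite /= gtn_eqF.
rewrite ltnS leq_eqVlt => /predU1P[-> {i}|]; last exact: eq_a.
by rewrite eq_e //; case: s; rewrite /= ?eqxx.
Qed.

Lemma close_sat (M : structure) k phi :
    (forall e : assignment M, sat e phi) ->
  forall e : assignment M, sat e (close k phi).
Proof. by move=> sat_phi; elim: k => //= k IHk e a b. Qed.

(** The factor [a 0] makes the condition void when the leading coefficient is
    [0].  Degree [1] yields inverses, and these reduce the general case to monic
    polynomials. *)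
Lemma alg_closed_fieldP (R : idomainType) :
  alg_closed_field R <-> forall n (a : nat -> R), exists x,
    a 0%N * (\sum_(j < n.+2) a (n.+1 - j)%N * x ^+ j) = 0.
Proof.
have recr n (a : nat -> R) x : \sum_(j < n.+2) a (n.+1 - j)%N * x ^+ j =
    a 0%N * x ^+ n.+1 + \sum_(j < n.+1) a (n.+1 - j)%N * x ^+ j.
  by rewrite big_ord_recr /= subnn addrC.
split=> [[fieldR closedR] n a|ax].
  have [->|nz_a] := eqVneq (a 0%N) 0; first by exists 0; rewrite mul0r.
  have [//|x Dx] := closedR n.+1 (fun j => - (a (n.+1 - j)%N / a 0%N)).
  exists x; rewrite recr Dx mulr_sumr -big_split big1 ?mulr0 //= => j _.
  by rewrite mulrA mulrN mulrCA divrr ?mulr1 ?mulNr ?addNr //; apply: fieldR.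
split=> [x nz_x|[//|n] P _].
  pose a i : R := if i == 0%N then x else - 1.
  have [y] := ax 0%N a; rewrite recr big_ord1 expr0 mulr1 expr1 => /eqP.
  rewrite mulf_eq0 (negPf nz_x) subr_eq0 => /eqP xy1.
  by apply/unitrPr; exists y.
pose a i := if i == 0%N then 1 else - P (n.+1 - i)%N.
have [x] := ax n a; rewrite recr !mul1r => /eqP; rewrite addr_eq0 => /eqP Dx; exists x.
rewrite Dx -sumrN; apply: eq_bigr => j _.
by rewrite /a subn_eq0 leqNgt ltn_ord /= mulNr opprK subKn // ltnW.
Qed.

Variables (F K : idomainType) (chi : F -> K).

Local Notation M := (char_structure chi).

Implicit Type e : assignment M.

Definition assign (x : nat -> F) (y : nat -> K) : assignment M :=
  fun s => if s is Dom as s return nat -> M s then x else y.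

Lemma exists_assign s (a : nat -> sort_ring F K s) :
  exists e, e s = a.
Proof.
by case: s a => a; [exists (assign a (fun=> 0)) | exists (assign (fun=> 0) a)].
Qed.

Lemma eval_horner e s d i :
  eval e (horner_term s d i) =
  \sum_(j < i.+1) (e s (i - j)%N : sort_ring F K s) * e s d ^+ j.
Proof.
elim: i => [|i IHi]; first by rewrite big_ord1 expr0 mulr1.
rewrite big_ord_recl subn0 expr0 mulr1 addrC /= IHi mulr_suml.
by congr (_ + _); apply: eq_bigr => j _; rewrite exprSr mulrA.
Qed.

Lemma sat_horner e s d i :
  sat e (fEq (tMul (tVar s 0) (horner_term s d i)) (tZero s)) <->
  (e s 0%N : sort_ring F K s) *
    (\sum_(j < i.+1) (e s (i - j)%N : sort_ring F K s) * e s d ^+ j) = 0.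
Proof. by rewrite -eval_horner. Qed.

Lemma sat_closed_axiom s n :
  (forall e, sat e (closed_axiom s n)) <->
  forall a : nat -> sort_ring F K s, exists x,
    a 0%N * (\sum_(j < n.+2) a (n.+1 - j)%N * x ^+ j) = 0.
Proof.
split=> [sat_ax a|ax].
  have [ea Dea] := exists_assign a.
  have [e [eq_e [x /sat_horner sat_x]]] := sat_close (sat_ax ea) ea.
  exists x; rewrite -[RHS]sat_x update_other // eq_e // Dea.
  congr (_ * _); apply: eq_bigr => j _; have le_j := leq_subr j n.+1.
  by rewrite update_same update_other ?eq_e ?Dea ?ltn_eqF.
apply: close_sat => e; have [x Dx] := ax (e s); exists x.
apply/sat_horner; rewrite update_other // -[RHS]Dx.
congr (_ * _); apply: eq_bigr => j _; have le_j := leq_subr j n.+1.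
by rewrite update_same update_other // ltn_eqF.
Qed.

Lemma sat_closed_axioms s :
  (forall n e, sat e (closed_axiom s n)) <-> alg_closed_field (sort_ring F K s).
Proof.
split=> [ax|/alg_closed_fieldP closedR n].
  by apply/alg_closed_fieldP => n; apply/sat_closed_axiom.
exact/sat_closed_axiom.
Qed.

Lemma sat_kernel_axiom :
  (forall e, sat e kernel_axiom) <-> forall x, chi x = 1 -> x = 1.
Proof.
split=> [ax x|ax e a b]; last exact: ax.
by have := ax (assign (fun=> 0) (fun=> 0)) x 0.
Qed.

Lemma eval_numeral e c : eval e (numeral c) = c%:R :> K.
Proof. by elim: c => //= c ->; rewrite -natr1. Qed.

Lemma eval_range e j m :
  eval e (range_term j m) =
  \prod_(c < m) ((e Cod j : K) ^+ 2 - c.+1%:R ^+ 2) :> K.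
Proof.
elim: m => [|m IHm]; first by rewrite big_ord0.
by rewrite big_ord_recr -IHm /= eval_numeral natr1 !expr2.
Qed.

Lemma eval_sum e m i :
  eval e (sum_term m i) =
  (e Cod m : K) + \sum_(j < i) (e Cod j : K) * chi (e Dom j) :> K.
Proof.
elim: i => [|i IHi]; first by rewrite big_ord0 addr0.
by rewrite big_ord_recr addrA -IHi.
Qed.

Lemma eval_power e j N : eval e (power_term j N) = (e Dom j : F) ^+ N :> F.
Proof. by elim: N => [|N IHN] //=; rewrite exprSr -IHN. Qed.

Lemma eval_unity e N i :
  eval e (unity_term N i) = \prod_(j < i) ((e Dom j : F) ^+ N - 1) :> F.
Proof.
elim: i => [|i IHi]; first by rewrite big_ord0.
by rewrite big_ord_recr -IHi /= eval_power.
Qed.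

Lemma sat_relation_formula e m i :
  sat e (relation_formula m i) <->
  ((forall j, (j < i)%N ->
      \prod_(c < m) ((e Cod j : K) ^+ 2 - c.+1%:R ^+ 2) = 0 :> K) ->
    (e Cod m : K) + \sum_(j < m) (e Cod j : K) * chi (e Dom j) = 0 ->
    \prod_(j < m) ((e Dom j : F) ^+ (m.+1)`! - 1) = 0).
Proof.
elim: i => [|i IHi].
  rewrite [sat _ _]/= eval_sum eval_unity.
  by split=> [th _|th]; [exact: th | apply: th].
rewrite [sat _ _]/= eval_range; split=> [th rg|th rgi].
  apply: (IHi.1 (th (rg i (ltnSn i)))) => j lt_ji.
  by apply: rg; apply: leqW.
apply/IHi => rg; apply: th => j; rewrite ltnS leq_eqVlt.
by case/predU1P=> [->|/rg].
Qed.

Lemma sat_mann_axiom m :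
  (forall e, sat e (mann_axiom m)) <->
  forall (x : nat -> F) (y : nat -> K),
    (forall j, (j <= m)%N -> \prod_(c < m) (y j ^+ 2 - c.+1%:R ^+ 2) = 0) ->
    y m + \sum_(j < m) y j * chi (x j) = 0 ->
    \prod_(j < m) (x j ^+ (m.+1)`! - 1) = 0.
Proof.
split=> [sat_ax x y rg sum0|ax]; last first.
  by apply: close_sat => e; apply/sat_relation_formula; apply: ax.
have [e [eq_e]] := sat_close (sat_ax (assign x y)) (assign x y).
have eD j : (j <= m)%N -> e Dom j = x j by move=> le_j; rewrite eq_e.
have eC j : (j <= m)%N -> e Cod j = y j by move=> le_j; rewrite eq_e.
move/sat_relation_formula => th.
transitivity (\prod_(j < m) ((e Dom j : F) ^+ (m.+1)`! - 1)).
  by apply: eq_bigr => j _; rewrite eD // ltnW.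
apply: th => [j lt_j|]; first by rewrite eC // rg.
rewrite -[RHS]sum0 eC //; congr (_ + _); apply: eq_bigr => j _.
by rewrite eC ?eD // ltnW.
Qed.

End Semantics.

(** * First-order characterization of the generic characters *)

Section Characterization.

Local Open Scope ring_scope.

(** The fractions of integers form a subfield. *)
Lemma prime_field_frac (E : fieldType) (x : E) :
    [pchar E] =i pred0 -> prime_field x ->
  exists a b : int, b != 0 /\ b%:~R * x = a%:~R.
Proof.
move=> charE primex; have int0 := intr_eq0_pchar0 _ charE.
pose P (x : E) := exists a b : int, b != 0 /\ b%:~R * x = a%:~R.
pose S : {pred E} := fun x => `[< P x >].
suffices /primex/asboolP : divring_closed S by [].
split=> [|u v /asboolP[a [b [nzb Du]]] /asboolP[a' [b' [nzb' Dv]]]|].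
- by apply/asboolP; exists 1, 1; rewrite mul1r.
- apply/asboolP; exists (b' * a - b * a'), (b * b').
  split; first by rewrite mulf_neq0.
  rewrite rmorphB !rmorphM /= -Du -Dv; ring.
move=> u v /asboolP[a [b [nzb Du]]] /asboolP[a' [b' [nzb' Dv]]].
apply/asboolP; have [->|nzv] := eqVneq v 0.
  by exists 0, 1; rewrite invr0 !mulr0.
have nza' : a' != 0.
  by rewrite -int0 -Dv mulf_neq0 // int0.
exists (b' * a), (b * a'); split; first by rewrite mulf_neq0.
by rewrite !rmorphM /= -Du -Dv; field.
Qed.

Lemma prime_field_common_denominator (E : fieldType) (xs : seq E) :
    [pchar E] =i pred0 -> (forall x, x \in xs -> prime_field x) ->
  exists2 d : int, d != 0 & forall x, x \in xs -> exists a : int, d%:~R * x = a%:~R.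
Proof.
move=> charE; elim: xs => [|x xs IHxs] prime_xs; first by exists 1.
have [|d nzd dP] := IHxs.
  by move=> y xs_y; apply: prime_xs; rewrite inE xs_y orbT.
have [|a [b [nzb Dx]]] := @prime_field_frac _ x charE.
  by apply: prime_xs; rewrite mem_head.
exists (d * b) => [|y]; first by rewrite mulf_neq0.
rewrite inE rmorphM => /predU1P[->|/dP[a' Dy]].
  by exists (d * a); rewrite -mulrA Dx rmorphM.
by exists (b * a'); rewrite mulrAC Dy rmorphM mulrC.
Qed.

Lemma mult_independent_neq0 (F : idomainType) n (alpha : n.-tuple F) i :
  mult_independent alpha -> tnth alpha i != 0.
Proof.
move=> indep; apply/eqP => alpha0; apply: indep.
exists [tuple (l == i : nat) | l < n], [tuple (l == i).*2 | l < n]; split.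
  by move/(congr1 (fun t => tnth t i)); rewrite !tnth_mktuple eqxx.
by rewrite (bigD1 i) //= [RHS](bigD1 i) //= !tnth_mktuple eqxx alpha0 !expr0n !mul0r.
Qed.

Variables (F K : idomainType) (chi : F -> K).
Hypothesis charac : is_character chi.

Let chiM a b : chi (a * b) = chi a * chi b. Proof. by case: charac. Qed.
Let chi0 : chi 0 = 0. Proof. by case: charac. Qed.
Let chi1 : chi 1 = 1. Proof. by case: charac. Qed.

Definition mann_property := forall m (x : nat -> F) (y : nat -> K),
  (forall j, (j <= m)%N -> \prod_(c < m) (y j ^+ 2 - c.+1%:R ^+ 2) = 0) ->
  y m + \sum_(j < m) y j * chi (x j) = 0 ->
  \prod_(j < m) (x j ^+ (m.+1)`! - 1) = 0.

Lemma models_acfc :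
  models (char_structure chi) acfc <->
  [/\ alg_closed_field F, alg_closed_field K, forall x, chi x = 1 -> x = 1
    & mann_property].
Proof.
split=> [sat_acfc|[closedF closedK ker mann]].
  split.
  - apply: (sat_closed_axioms chi Dom).1 => n; apply: sat_acfc.
    by constructor 1; exists n.
  - apply: (sat_closed_axioms chi Cod).1 => n; apply: sat_acfc.
    by constructor 2; exists n.
  - by apply: (sat_kernel_axiom chi).1; apply: sat_acfc; constructor 3.
  - by move=> m; apply/sat_mann_axiom; apply: sat_acfc; constructor 4; exists m.
move=> phi [[n ->]|[n ->]|->|[m ->]].
- exact: (sat_closed_axioms chi Dom).2.
- exact: (sat_closed_axioms chi Cod).2.
- exact: (sat_kernel_axiom chi).2 ker.
- exact: (sat_mann_axiom chi m).2 (mann m).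
Qed.

(** With all [x j] equal to [0], the relation says that the integer [y m] is
    [0] in [K]. *)
Lemma mann_pchar0 : mann_property -> [pchar K] =i pred0.
Proof.
move=> mann p; apply/negP => /andP[p_pr /eqP p0].
have p_gt0 := prime_gt0 p_pr.
have : \prod_(j < p) ((0 : F) ^+ (p.+1)`! - 1) = 0.
  apply: (mann p (fun=> 0) (fun=> p%:R)) => [j _|].
    have lt_p : (p.-1 < p)%N by rewrite prednK.
    by rewrite (bigD1 (Ordinal lt_p)) //= prednK // subrr mul0r.
  by rewrite p0 big1 ?addr0 // => j _; rewrite mul0r.
move/eqP/prodf_eq0 => [j _]; rewrite expr0n gtn_eqF ?fact_gt0 // sub0r.
by rewrite oppr_eq0 oner_eq0.
Qed.

Lemma char_neq0 a : alg_closed_field F -> a != 0 -> chi a != 0.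
Proof.
move=> [fieldF _] /fieldF/unitrPr[b ab1]; apply: contra_neq (oner_neq0 K).
by move=> a0; rewrite -chi1 -ab1 chiM a0 mul0r.
Qed.

Lemma char_inj :
  alg_closed_field F -> (forall x, chi x = 1 -> x = 1) -> injective chi.
Proof.
move=> closedF ker a b eq_ab; have [b0|nzb] := eqVneq b 0.
  apply/eqP; rewrite b0; apply: contraT => /(char_neq0 closedF).
  by rewrite eq_ab b0 chi0 eqxx.
have unit_b : b \is a GRing.unit by case: closedF => fieldF _; apply: fieldF.
apply: (mulIr (_ : b^-1 \is a GRing.unit)); rewrite ?unitrV // divrr //.
by apply: ker; rewrite chiM eq_ab -chiM divrr.
Qed.

Lemma range_intr (a : int) m :
    a != 0 -> (`|a|%N <= m)%N ->
  \prod_(c < m) (a%:~R ^+ 2 - c.+1%:R ^+ 2) = 0 :> K.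
Proof.
move=> nz_a le_am; have a_gt0 : (0 < `|a|)%N by rewrite absz_gt0.
have lt_am : (`|a|.-1 < m)%N by rewrite prednK.
rewrite (bigD1 (Ordinal lt_am)) //= prednK //.
have -> : a%:~R ^+ 2 = `|a|%:R ^+ 2 :> K.
  by case: (a) => // k; rewrite NegzE mulrNz sqrrN.
by rewrite subrr mul0r.
Qed.

Lemma range_intrP (a : K) m :
    [pchar K] =i pred0 -> \prod_(c < m) (a ^+ 2 - c.+1%:R ^+ 2) = 0 ->
  exists2 b : int, b != 0 & a = b%:~R.
Proof.
move=> charK /eqP/prodf_eq0[c _]; rewrite subr_sqr mulf_eq0 subr_eq0 addr_eq0.
by case/orP=> /eqP->; [exists c.+1%:Z | exists (- c.+1%:Z); rewrite ?mulrNz].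
Qed.

(** The constant term [y m] is the distinguished term of [generic_relation], and
    the terms with [x j = 0] are left out of the relation. *)
Lemma generic_mann :
    alg_closed_field F -> alg_closed_field K -> [pchar K] =i pred0 ->
  generic chi -> mann_property.
Proof.
move=> closedF closedK charK gen m x y rg sum0.
have /choice[c cP] (i : 'I_m.+1) : exists c : int, c != 0 /\ y i = c%:~R.
  have [|c nzc Dy] := @range_intrP (y i) m charK; last by exists c.
  by apply: rg; rewrite -ltnS.
(* The constant term is the one where the element of [F] is [1]. *)
pose X (i : 'I_m.+1) := if (i < m)%N then x i else 1.
pose A := [set i | X i != 0].
have X_max : X ord_max = 1 by rewrite /X ltnn.
have X_lift (i : 'I_m) : X (widen_ord (leqnSn m) i) = x i by rewrite /X /= ltn_ord.
have [|||||j [Aj ne_j Xj]] := @generic_relation F K chi _ A c X m.+1 ord_max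
  charac closedF closedK charK gen.
- by have := max_card (mem A); rewrite card_ord.
- by rewrite inE X_max oner_neq0.
- by move=> i _; case: (cP i).
- by move=> i; rewrite inE.
- rewrite -[RHS]sum0 big_mkcond big_ord_recr [RHS]addrC; congr (_ + _).
    apply: eq_bigr => i _; rewrite inE X_lift -(cP _).2 /=.
    by case: eqP => [->|//]; rewrite chi0 mulr0.
  by rewrite inE X_max oner_neq0 chi1 mulr1 -(cP ord_max).2.
have lt_jm : (j < m)%N.
  rewrite ltn_neqAle -ltnS ltn_ord andbT.
  by apply: contraNneq ne_j => jm; apply/eqP/val_inj.
rewrite (bigD1 (Ordinal lt_jm)) //=; move: Xj.
by rewrite X_max expr1n {1}/X lt_jm => ->; rewrite subrr mul0r.
Qed.

(** Clear the denominators of a polynomial vanishing at the image of [alpha] and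
    divide by one of its monomials: this is a relation between images of
    quotients of monomials, and a quotient of two distinct monomials is not a
    root of unity. *)
Lemma mann_generic :
    alg_closed_field F -> (forall x, chi x = 1 -> x = 1) -> mann_property ->
  generic chi.
Proof.
move=> closedF ker mann; have charK := mann_pchar0 mann.
split=> [|n alpha _ indep P primeP P0]; first exact: char_inj.
have chiX a k : chi (a ^+ k) = chi a ^+ k.
  by elim: k => [|k IHk]; rewrite ?expr0 // !exprS chiM IHk.
have charE : [pchar {fraction K}] =i pred0.
  apply/pcharf0P=> k; rewrite -(rmorph_nat (@tofrac K)) tofrac_eq0.
  by move/pcharf0P: charK => ->.
apply/eqP; rewrite -msupp_eq0; apply/negP => /negP nzP.
have [|d nzd dP] := @prime_field_common_denominator _
  [seq P@_k | k <- msupp P] charE.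
  by move=> _ /mapP[k _ ->].
have /choice[c cP] (k : 'X_{1..n}) : exists c : int,
    k \in msupp P -> d%:~R * P@_k = c%:~R.
  have [Pk|] := boolP (k \in msupp P); last by exists 0.
  by have [a Da] := dP _ (map_f (fun k => P@_k) Pk); exists a.
have nzc k : k \in msupp P -> c k != 0.
  move=> Pk; rewrite -(intr_eq0_pchar0 _ charE) -cP //.
  by rewrite mulf_neq0 ?intr_eq0_pchar0 // -mcoeff_msupp.
pose mon (k : 'X_{1..n}) : F := \prod_(i < n) tnth alpha i ^+ k i.
have nz_mon k : mon k != 0.
  by apply/prodf_neq0 => i _; rewrite expf_neq0 // mult_independent_neq0.
have unit_mon k : mon k \is a GRing.unit by case: closedF => fieldF _; apply: fieldF.
have sumP : \sum_(k <- msupp P) (c k)%:~R * chi (mon k) = 0.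
  apply/eqP; rewrite -tofrac_eq0 rmorph_sum /=; apply/eqP.
  transitivity
    (d%:~R * P.@[tnth [tuple tofrac (chi (tnth alpha i)) | i < n]]); last first.
    by rewrite P0 mulr0.
  rewrite mevalE mulr_sumr; apply: eq_big_seq => k Pk.
  rewrite rmorphM rmorph_int mulrA cP //; congr (_ * _).
  rewrite (big_morph chi chiM chi1) (rmorph_prod (@tofrac K)) /=.
  by apply: eq_bigr => i _; rewrite tnth_mktuple chiX rmorphXn.
case Ds: (msupp P) nzP => [//|k0 s] _.
have P_s k : k \in s -> k \in msupp P by rewrite Ds inE orbC => ->.
have P_k0 : k0 \in msupp P by rewrite Ds mem_head.
have k0's : k0 \notin s by have := msupp_uniq P; rewrite Ds => /andP[].
pose B := (\sum_(k <- msupp P) `|c k|)%N.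
have leB k : k \in msupp P -> (`|c k| <= B)%N.
  by move=> Pk; rewrite /B (big_rem k) //= leq_addr.
(* A common bound on the length and on the coefficients; the relation is padded
   with terms where [x j] is [0] and [y j] is [1]. *)
pose m := (size s + B)%N.
pose x j := if (j < size s)%N then mon (nth k0 s j) / mon k0 else 0.
pose y j : int := if (j < size s)%N then c (nth k0 s j) else
  if j == m then c k0 else 1.
have B_gt0 : (0 < B)%N by apply: leq_trans (leB k0 P_k0); rewrite absz_gt0 nzc.
have y_m : y m = c k0 by rewrite /y ltnNge leq_addr /= eqxx.
have y_range j : (y j != 0) && (`|y j| <= m)%N.
  rewrite /y; have [lt_j|_] := ltnP.
    have /P_s Pk := mem_nth k0 lt_j.
    by rewrite nzc // (leq_trans (leB _ Pk)) // leq_addl.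
  have [_|_] := eqVneq j m.
    by rewrite nzc // (leq_trans (leB _ P_k0)) // leq_addl.
  by rewrite (leq_trans B_gt0) ?leq_addl.
have rel : \prod_(j < m) (x j ^+ (m.+1)`! - 1) = 0.
  apply: (mann m x (fun j => (y j)%:~R)) => [j _|].
    by case/andP: (y_range j); apply: range_intr.
  apply: (mulIf (char_neq0 closedF (nz_mon k0))); rewrite mul0r -[RHS]sumP.
  rewrite Ds big_cons mulrDl y_m; congr (_ + _).
  rewrite mulr_suml (big_nth k0).
  rewrite -(big_mkord predT (fun j => (y j)%:~R * chi (x j) * chi (mon k0))) /=.
  rewrite (big_cat_nat (n := size s)) //= ?leq_addr //.
  rewrite [X in _ + X]big1_seq ?addr0 => [|j /=]; last first.
    rewrite mem_index_iota leqNgt /x => /andP[/negPf -> _].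
    by rewrite chi0 mulr0 mul0r.
  apply: eq_big_nat => j /= lt_j; rewrite -mulrA -chiM /x /y lt_j.
  by rewrite divrK.
move/eqP: rel => /prodf_eq0[j _]; rewrite subr_eq0 /x.
case: ltnP => [lt_j|_]; last by rewrite expr0n gtn_eqF ?fact_gt0 // eq_sym oner_eq0.
set k := nth k0 s j; set N := (m.+1)`! => /eqP xN.
have s_k : k \in s by apply: mem_nth.
case/negP: k0's; suffices -> : k0 = k by [].
have eqN : mon k ^+ N = mon k0 ^+ N.
  apply: (mulIr (_ : mon k0 ^- N \is a GRing.unit)).
    by rewrite unitrV unitrX.
  by rewrite -[in LHS]exprVn -exprMn xN divrr // unitrX.
have monN l : mon l ^+ N = monomial alpha [tuple (l i * N)%N | i < n].
  rewrite /mon /monomial -prodrXl; apply: eq_bigr => i _.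
  by rewrite tnth_mktuple exprM.
move: eqN; rewrite !monN => /(mult_independent_monomial indep) eqN.
apply/mnmP => i; have /eqP := congr1 (fun t => tnth t i) eqN.
by rewrite !tnth_mktuple eqn_pmul2r ?fact_gt0 // => /eqP.
Qed.

Lemma models_acfcP :
  models (char_structure chi) acfc <->
  [/\ alg_closed_field F, alg_closed_field K, [pchar K] =i pred0 & generic chi].
Proof.
rewrite models_acfc.
split=> [[closedF closedK ker mann]|[closedF closedK charK gen]].
  by split=> //; [apply: mann_pchar0 | apply: mann_generic].
split=> //; last exact: generic_mann.
by move=> x; rewrite -chi1 => /gen.1.
Qed.

End Characterization.

Section AlgebraicOverFinite.

Local Open Scope ring_scope.

(** The powers of [x] are represented by the finitely many polynomials over [k]
    of bounded degree. *)
Lemma algebraic_over_finite_expr (k : finFieldType) (F : fieldType)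
    (iota : {rmorphism k -> F}) (x : F) :
  algebraicOver iota x -> exists i j, i <> j /\ x ^+ i = x ^+ j.
Proof.
case=> p nzp px; pose T := {ffun 'I_(size p) -> k}.
pose f (i : 'I_#|T|.+1) : T := [ffun j : 'I_(size p) => ('X^i %% p)`_j].
have /injectivePn[i [j ne_ij eq_f]] : ~~ injectiveb f.
  by apply/injectiveP => /leq_card; rewrite card_ord ltnn.
have xE n : x ^+ n = (map_poly iota ('X^n %% p)).[x].
  rewrite -[LHS]hornerXn -(map_polyXn iota) {1}(divp_eq 'X^n p).
  by rewrite rmorphD rmorphM hornerD hornerM (rootP px) mulr0 add0r.
exists i, j; split=> [/val_inj/eqP|]; first exact/negP.
rewrite !xE; congr (map_poly iota _).[x]; apply/polyP => l.
have [lt_l|le_l] := ltnP l (size p); last first.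
  by rewrite !nth_default // ltnW // (leq_trans _ le_l) // ltn_modp.
by have := congr1 (fun g : T => g (Ordinal lt_l)) eq_f; rewrite !ffunE.
Qed.

(** Genericity reduces to injectivity, as no nonempty tuple is multiplicatively
    independent. *)
Lemma algebraic_over_finite_generic (k : finFieldType) (F : fieldType)
    (iota : {rmorphism k -> F}) (K : idomainType) (chi : F -> K) :
  (forall x, algebraicOver iota x) -> injective chi -> generic chi.
Proof.
move=> algF chi_inj; split=> // -[//|n] alpha _ indep; case: indep.
have [i [j [ne_ij eq_ij]]] := algebraic_over_finite_expr (algF (thead alpha)).
exists [tuple of i :: nseq n 0%N], [tuple of j :: nseq n 0%N]; split.
  by case/(congr1 val).
rewrite !big_ord_recl !tnth0 -/(thead alpha) eq_ij; congr (_ * _).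
by apply: eq_bigr => l _; rewrite !tnthS.
Qed.

Lemma complex_alg_closed (R : realType) :
  alg_closed_field R[i] /\ [pchar R[i]] =i pred0.
Proof.
split; last exact: pchar_num.
by split=> [x|]; [rewrite unitfE | exact: complex_acf_axiom].
Qed.

End AlgebraicOverFinite.

Local Open Scope ring_scope.

Theorem theorem1p1 :
  exists ACFC : formula -> Prop,
    [/\ recursive_theory ACFC,
        forall phi, ACFC phi -> sentence phi /\ forall_exists phi,
        forall (F K : idomainType) (chi : F -> K), is_character chi ->
          (models (char_structure chi) ACFC <->
           [/\ alg_closed_field F, alg_closed_field K,
               [pchar K] =i pred0 & generic chi])
      & forall (p : nat), prime p ->
          forall (k : finFieldType) (F : fieldType)
            (iota : {rmorphism k -> F}),
          algebraic_closure iota -> p \in [pchar F] ->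
          forall (R : realType) (chi : F -> R[i]),
          is_character chi -> injective chi ->
          models (char_structure chi) ACFC].
Proof.
exists acfc.
split=> [||F K chi charac|p _ k F iota [closedF algF] _ R chi charac inj].
- exact: acfc_recursive.
- exact: acfc_sentence.
- exact: models_acfcP.
have [closedC charC] := complex_alg_closed R.
apply/(models_acfcP charac); split=> //.
exact: algebraic_over_finite_generic algF inj.
Qed.
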